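(* For a replete subsemigroup $S$ of $T_n$, let $\bar\alpha_m(S)$ be the subset of $\bar\alpha(S)$ consisting of those minimal elements $A$ of $\bar\alpha(S)$ for which $|\mathrm{lmp}(S_A)| = |\mathrm{rmp}(S_A)| = 1$. Then the cardinality of the free mirig $R_n$ on $n$ generators is $$|R_n| = \sum_{S} \ \sum_{E \subseteq \bar{\alpha}_m(S)} 2^{|\bar{\alpha}(S)|-|E|} \prod_{A \in E}\ \prod_{j=1}^{|A|-1} j^{\,2^{(|A|-j+1)}-2},$$ where the outer sum ranges over all replete subsemigroups $S$ of $T_n$.
   Context: A mirig is a rig (semiring with $0$ and $1$, addition commutative, multiplication not assumed commutative, $0$ absorbing for multiplication) in which $x^2 = x$ for all $x$. $R_n$ denotes the free mirig on an $n$-element set $[n]$, i.e. the quotient of the free (noncommutative) rig on $[n]$ by the congruence generated by $r \approx r^2$ for all $r$. Trees. $F_n$ is the free monoid (words) on $[n]$; $\sim$ is the congruence on $F_n$ generated by $w \sim ww$ for all words $w$. The set $T_n$ of trees and the alphabet map $\alpha : T_n \to \mathcal{P}([n])$ (power set) are defined inductively: the trivial tree $()$ is in $T_n$ with $\alpha(()) = \emptyset$; if $t_0,t_1 \in T_n$, $a_0 \in [n]\setminus\alpha(t_0)$, $a_1 \in [n]\setminus\alpha(t_1)$ and $\alpha(t_0)\cup\{a_0\} = \{a_1\}\cup\alpha(t_1)$, then $t=(t_0,a_0,a_1,t_1) \in T_n$ with $\alpha(t) = \alpha(t_0)\cup\{a_0\}$; its components are denoted $t_0, a^t_0, a^t_1,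 t_1$. For a word $w$, $\alpha(w)$ is its set of letters. The map $\mathrm{tr}: F_n \to T_n$ sends the empty word to $()$ and a non-empty word $w$ to $(\mathrm{tr}(p),a,b,\mathrm{tr}(q))$, where $p$ is the maximal prefix of $w$ containing all but one of the generators in $\alpha(w)$, $a$ is the sole element of $\alpha(w)\setminus\alpha(p)$, $q$ is the maximal suffix of $w$ containing all but one of the generators in $\alpha(w)$, and $b$ is the sole element of $\alpha(w)\setminus\alpha(q)$. The map $\mathrm{tr}$ is surjective and $\mathrm{tr}(w)=\mathrm{tr}(w')$ iff $w\sim w'$, so $T_n$ carries a unique monoid structure (written by juxtaposition, identity $()$) making $\mathrm{tr}$ a homomorphism. Subsemigroups. A subsemigroup of $T_n$ is a (possibly empty) subset closed under products. A subsemigroup $S$ is replete if for all $x,y\in T_n$ the set $x\backslash S/y := \{t\in T_n \mid xty\in S\}$ is a subsemigroup. For $U\subseteq T_n$, $\bar\alpha(U) := \{\alpha(t)\mid t\in U\}$, and for $A\subseteq[n]$, $U_A := \{t\in U\mid \alpha(t)=A\}$. Minimality in $\bar\alpha(S)$ is with respect to inclusion. Paths. The leftmost path $\mathrm{lmp}(t)$ and rightmost path $\mathrm{rmp}(t)$ of a tree are the sequences of generators defined recursively by $\mathrm{lmp}(())=\mathrm{rmp}(())=$ the empty sequence, $\mathrm{lmp}(t)$ is $\mathrm{lmp}(t_0)$ followed by $a^t_0$, and $\mathrm{rmp}(t)$ is $a^t_1$ followed by $\mathrm{rmp}(t_1)$. For a set $U$ of trees, $\mathrm{lmp}(U)=\{\mathrm{lmp}(t)\mid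 t\in U\}$ and $\mathrm{rmp}(U)=\{\mathrm{rmp}(t)\mid t\in U\}$. *)

(* Defs.v *)
From HB Require Import structures.
From mathcomp Require Import all_boot all_algebra.
From mathcomp Require Import finmap multiset.
From mathcomp Require Import boolp.

Import GRing.Theory.

Set Implicit Arguments.
Unset Strict Implicit.
Unset Printing Implicit Defensive.

(* The free rig on [n] is the rig N<F_n> of noncommutative polynomials with
   natural number coefficients, i.e. finite multisets of words. *)
Definition freeRig (n : nat) := {mset seq 'I_n}%mset.

Section FreeRig.
Variable n : nat.
Implicit Types x y z : {mset seq 'I_n}%mset.

HB.instance Definition _ := Choice.on (freeRig n).

Definition frmul x y : {mset seq 'I_n}%mset := seq_mset [seq u ++ v | u <- x, v <- y].

Lemma perm_msetD x y : perm_eq (x `+` y)%mset (x ++ y).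
Proof. by apply/allP => w _ /=; rewrite count_cat !count_mem_mset msetE2. Qed.

Lemma frmulE x y w :
  frmul x y w = \sum_(u <- x) \sum_(v <- y) (u ++ v == w).
Proof.
rewrite mset_seqE; elim: (enum_mset x) => [|u s IHs]; first by rewrite big_nil.
rewrite allpairs_cons count_cat IHs big_cons; congr (_ + _).
by rewrite count_map -sum1_count big_mkcond; apply: eq_bigr => v _ /=; case: eqP.
Qed.

Lemma frmulA : associative frmul.
Proof.
move=> x y z; apply/msetP => w; rewrite !frmulE.
rewrite [RHS](perm_big _ (perm_eq_seq_mset _)) big_allpairs_dep /=.
apply: eq_bigr => u _.
rewrite (perm_big _ (perm_eq_seq_mset _)) big_allpairs_dep /=.
by apply: eq_bigr => v _; apply: eq_bigr => v' _; rewrite catA.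
Qed.

Lemma frmul1r : left_id [mset [::]]%mset frmul.
Proof.
move=> x; apply/msetP => w; rewrite frmulE enum_msetn big_seq1.
rewrite -count_mem_mset -sum1_count [RHS]big_mkcond.
by apply: eq_bigr => v _ /=; case: eqP.
Qed.

Lemma frmulr1 : right_id [mset [::]]%mset frmul.
Proof.
move=> x; apply/msetP => w; rewrite frmulE enum_msetn.
rewrite -count_mem_mset -sum1_count [RHS]big_mkcond; apply: eq_bigr => v _ /=.
by rewrite big_seq1 cats0; case: eqP.
Qed.

Lemma frmulDl : left_distributive frmul (fun x y => x `+` y)%mset.
Proof.
move=> x y z; apply/msetP => w; rewrite msetE2 !frmulE.
by rewrite (perm_big _ (perm_msetD x y)) big_cat.
Qed.

Lemma frmulDr : right_distributive frmul (fun x y => x `+` y)%mset.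
Proof.
move=> x y z; apply/msetP => w; rewrite msetE2 !frmulE -big_split /=.
by apply: eq_bigr => u _; rewrite (perm_big _ (perm_msetD y z)) big_cat.
Qed.

Lemma frmul0r : left_zero mset0 frmul.
Proof. by move=> x; apply/msetP => w; rewrite frmulE big_mset0 mset0E. Qed.

Lemma frmulr0 : right_zero mset0 frmul.
Proof.
move=> x; apply/msetP => w; rewrite frmulE mset0E big1 // => u _.
by rewrite big_mset0.
Qed.

HB.instance Definition _ := GRing.isPzSemiRing.Build (freeRig n)
  (@msetDA _) (@msetDC _) (@mset0D _) frmulA frmul1r frmulr1 frmulDl frmulDr
  frmul0r frmulr0.

Inductive mirigCong : freeRig n -> freeRig n -> Prop :=
| mirigCong_sqr r : mirigCong r (r * r)%R
| mirigCong_refl r : mirigCong r r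
| mirigCong_sym r s : mirigCong r s -> mirigCong s r
| mirigCong_trans r s t : mirigCong r s -> mirigCong s t -> mirigCong r t
| mirigCong_add r r' s s' :
    mirigCong r r' -> mirigCong s s' -> mirigCong (r + s)%R (r' + s')%R
| mirigCong_mul r r' s s' :
    mirigCong r r' -> mirigCong s s' -> mirigCong (r * s)%R (r' * s')%R.

Definition mirigCongb : rel (freeRig n) := fun r s => `[< mirigCong r s >].

Lemma mirigCongb_refl : reflexive mirigCongb.
Proof. by move=> r; apply/asboolP; constructor. Qed.

Lemma mirigCongb_sym : symmetric mirigCongb.
Proof.
by move=> r s; apply/asboolP/asboolP; apply: mirigCong_sym.
Qed.

Lemma mirigCongb_trans : transitive mirigCongb.
Proof.
move=> s r t /asboolP rs /asboolP st; apply/asboolP.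
exact: mirigCong_trans rs st.
Qed.

Canonical mirigCong_equiv :=
  EquivRel mirigCongb mirigCongb_refl mirigCongb_sym mirigCongb_trans.

End FreeRig.

Definition freeMirig (n : nat) := {eq_quot @mirigCongb n}%qT.

Section FreeMirig.
Variable n : nat.
Local Open Scope quotient_scope.
Local Open Scope ring_scope.
Local Notation R_n := (freeMirig n).
Implicit Types x y z : R_n.

HB.instance Definition _ := Choice.on R_n.
HB.instance Definition _ := EqQuotient.on R_n.

Lemma fm_eqP (r s : freeRig n) :
  reflect (mirigCong r s) (\pi_R_n r == \pi_R_n s).
Proof. by rewrite piE; apply: asboolP. Qed.

Definition fm_add := lift_op2 R_n (fun r s : freeRig n => r + s).
Definition fm_mul := lift_op2 R_n (fun r s : freeRig n => r * s).

Lemma fm_repr (r : freeRig n) : mirigCong (repr (\pi_R_n r)) r.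
Proof. by apply/fm_eqP; rewrite reprK. Qed.

Lemma fm_piD (r s : freeRig n) :
  \pi_R_n (r + s) = fm_add (\pi_R_n r) (\pi_R_n s).
Proof.
rewrite /fm_add; unlock.
by apply/eqP/fm_eqP/mirigCong_sym/mirigCong_add; apply: fm_repr.
Qed.

Lemma fm_piM (r s : freeRig n) :
  \pi_R_n (r * s) = fm_mul (\pi_R_n r) (\pi_R_n s).
Proof.
rewrite /fm_mul; unlock.
by apply/eqP/fm_eqP/mirigCong_sym/mirigCong_mul; apply: fm_repr.
Qed.

Fact fm_addA : associative fm_add.
Proof.
by move=> x y z; rewrite -[x]reprK -[y]reprK -[z]reprK -!fm_piD addrA.
Qed.
Fact fm_addC : commutative fm_add.
Proof. by move=> x y; rewrite -[x]reprK -[y]reprK -!fm_piD addrC. Qed.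
Fact fm_add0 : left_id (\pi_R_n 0) fm_add.
Proof. by move=> x; rewrite -[x]reprK -fm_piD add0r. Qed.
Fact fm_mulA : associative fm_mul.
Proof.
by move=> x y z; rewrite -[x]reprK -[y]reprK -[z]reprK; rewrite -!fm_piM mulrA.
Qed.
Fact fm_mul1 : left_id (\pi_R_n 1) fm_mul.
Proof. by move=> x; rewrite -[x]reprK -fm_piM mul1r. Qed.
Fact fm_mulr1 : right_id (\pi_R_n 1) fm_mul.
Proof. by move=> x; rewrite -[x]reprK -fm_piM mulr1. Qed.
Fact fm_mulDl : left_distributive fm_mul fm_add.
Proof.
by move=> x y z; rewrite -[x]reprK -[y]reprK -[z]reprK;
  rewrite -fm_piD -!fm_piM -fm_piD mulrDl.
Qed.
Fact fm_mulDr : right_distributive fm_mul fm_add.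
Proof.
by move=> x y z; rewrite -[x]reprK -[y]reprK -[z]reprK;
  rewrite -fm_piD -!fm_piM -fm_piD mulrDr.
Qed.
Fact fm_mul0 : left_zero (\pi_R_n 0) fm_mul.
Proof. by move=> x; rewrite -[x]reprK -fm_piM mul0r. Qed.
Fact fm_mulr0 : right_zero (\pi_R_n 0) fm_mul.
Proof. by move=> x; rewrite -[x]reprK -fm_piM mulr0. Qed.

HB.instance Definition _ := GRing.isPzSemiRing.Build R_n
  fm_addA fm_addC fm_add0 fm_mulA fm_mul1 fm_mulr1 fm_mulDl fm_mulDr
  fm_mul0 fm_mulr0.

Lemma fm_mulrr x : x * x = x.
Proof.
rewrite -[x]reprK -[LHS]fm_piM.
exact/eqP/fm_eqP/mirigCong_sym/mirigCong_sqr.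
Qed.

End FreeMirig.

Inductive preTree (n : nat) :=
| Triv
| Node of preTree n & 'I_n & 'I_n & preTree n.
Arguments Triv {n}.

Section PreTree.
Variable n : nat.

Fixpoint encode (t : preTree n) : GenTree.tree 'I_n :=
  if t is Node t0 a0 a1 t1 then
    GenTree.Node 1 [:: encode t0; GenTree.Leaf a0; GenTree.Leaf a1; encode t1]
  else GenTree.Node 0 [::].

Fixpoint decode (t : GenTree.tree 'I_n) : preTree n :=
  if t is GenTree.Node 1 [:: t0; GenTree.Leaf a0; GenTree.Leaf a1; t1] then
    Node (decode t0) a0 a1 (decode t1)
  else Triv.

Lemma encodeK : cancel encode decode.
Proof. by elim=> [|t0 IH0 a0 a1 t1 IH1] //=; rewrite IH0 IH1. Qed.

HB.instance Definition _ := Countable.copy (preTree n) (can_type encodeK).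

Implicit Types t : preTree n.

Fixpoint palpha t : {set 'I_n} :=
  if t is Node t0 a0 _ _ then a0 |: palpha t0 else set0.

Fixpoint istree t : bool :=
  if t is Node t0 a0 a1 t1 then
    [&& istree t0, istree t1, a0 \notin palpha t0, a1 \notin palpha t1
      & a0 |: palpha t0 == a1 |: palpha t1]
  else true.

Fixpoint plmp t : seq 'I_n :=
  if t is Node t0 a0 _ _ then rcons (plmp t0) a0 else [::].

Fixpoint prmp t : seq 'I_n :=
  if t is Node _ _ a1 t1 then a1 :: prmp t1 else [::].

Fixpoint pword t : seq 'I_n :=
  if t is Node t0 a0 a1 t1 then pword t0 ++ a0 :: a1 :: pword t1 else [::].

Fixpoint preTrees (d : nat) : seq (preTree n) :=
  if d is d'.+1 then
    Triv :: [seq Node p.1 a.1 a.2 p.2 |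
      p <- [seq (t0, t1) | t0 <- preTrees d', t1 <- preTrees d'],
      a <- enum {: 'I_n * 'I_n}]
  else [:: Triv].

Lemma mem_preTrees d t : istree t -> #|palpha t| <= d -> t \in preTrees d.
Proof.
elim: d t => [|d IHd] [|t0 a0 a1 t1] //=.
  by move=> /and5P[_ _ a0t0 _ _]; rewrite cardsU1 a0t0.
move=> /and5P[t0T t1T a0t0 a1t1 /eqP e] led; rewrite inE /=.
apply/allpairsPdep; exists (t0, t1), (a0, a1); split=> //; last first.
  by rewrite mem_enum.
apply/allpairsP; exists (t0, t1); split=> //=; apply: IHd => //.
  by move: led; rewrite cardsU1 a0t0.
by move: led; rewrite e cardsU1 a1t1.
Qed.

End PreTree.

Record tree (n : nat) := Tree { tval : preTree n; _ : istree tval }.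

Section Tree.
Variable n : nat.

HB.instance Definition _ := [isSub for @tval n].
HB.instance Definition _ := [Countable of tree n by <:].

Definition tree_enum : seq (tree n) := undup (pmap insub (preTrees n n)).

Fact tree_enumP : Finite.axiom tree_enum.
Proof.
apply: Finite.uniq_enumP; first exact: undup_uniq.
move=> t; rewrite mem_undup mem_pmap_sub inE; apply: mem_preTrees.
  exact: valP.
by apply: leq_trans (max_card _) _; rewrite card_ord.
Qed.

HB.instance Definition _ := isFinite.Build (tree n) tree_enumP.

Implicit Types (t : tree n) (v w : seq 'I_n) (a b c x : 'I_n).

Definition alpha t : {set 'I_n} := palpha (tval t).
Definition lmp t : seq 'I_n := plmp (tval t).
Definition rmp t : seq 'I_n := prmp (tval t).

Definition walpha w : {set 'I_n} := [set a in w].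

Definition maxpref w : seq 'I_n :=
  take (\max_(k < (size w).+1 | #|walpha w :\: walpha (take k w)| == 1) k) w.

Definition maxsuff w : seq 'I_n := rev (maxpref (rev w)).

(* The sole element of a singleton A; the default value x is never used. *)
Definition sole (x : 'I_n) (A : {set 'I_n}) : 'I_n := odflt x [pick a in A].

(* k is fuel: maxpref w and maxsuff w have exactly one letter fewer than w, so
   k = #|walpha w| is enough. *)
Fixpoint ptr (k : nat) w : preTree n :=
  match k, w with
  | k'.+1, x :: _ =>
      let p := maxpref w in
      let q := maxsuff w in
      Node (ptr k' p) (sole x (walpha w :\: walpha p))
           (sole x (walpha w :\: walpha q)) (ptr k' q)
  | _, _ => Triv
  end.

Definition before a w := take (index a w) w.
Definition after a w := rev (before a (rev w)).

Lemma walpha_cat u w : walpha (u ++ w) = walpha u :|: walpha w.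
Proof. by apply/setP=> a; rewrite !inE mem_cat. Qed.

Lemma walpha_rev w : walpha (rev w) = walpha w.
Proof. by apply/setP=> a; rewrite !inE mem_rev. Qed.

Lemma walpha0 w : (#|walpha w| == 0) = (w == [::]).
Proof.
rewrite cards_eq0; apply/eqP/eqP => [|->]; last by apply/setP=> a; rewrite !inE.
by case: w => // a w /setP/(_ a); rewrite !inE eqxx.
Qed.

Lemma before_notin a w : a \notin before a w.
Proof. by rewrite /before; elim: w => //= b w IHw; case: eqVneq => //= ba;
  rewrite inE negb_or eq_sym ba. Qed.

Lemma before_cat a u w :
  before a (u ++ w) = if a \in u then before a u else u ++ before a w.
Proof.
rewrite /before index_cat; case: ifP => au.
  by rewrite takel_cat // index_size.
by rewrite take_cat ltnNge leq_addr /= addKn.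
Qed.

Lemma walpha_before a w : walpha (before a w) \subset walpha w.
Proof. by apply/subsetP=> b; rewrite !inE; apply: mem_take. Qed.

Lemma beforeP a w : a \in w -> exists w', w = before a w ++ a :: w'.
Proof.
move=> aw; exists (drop (index a w).+1 w).
by rewrite -{2}(nth_index a aw) -drop_nth ?index_mem // cat_take_drop.
Qed.

Lemma before_before a c w :
  c \in w -> a \in before c w -> before a w = before a (before c w).
Proof.
by move=> cw ac; have [w' e] := beforeP cw; rewrite {1}e before_cat ac.
Qed.

Lemma after_cat a u w :
  after a (u ++ w) = if a \in w then after a w else after a u ++ w.
Proof.
by rewrite /after rev_cat before_cat mem_rev; case: ifP; rewrite ?rev_cat ?revK.
Qed.

Lemma after_notin a w : a \notin after a w.
Proof. by rewrite mem_rev before_notin. Qed.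

Lemma after_after a c w :
  c \in w -> a \in after c w -> after a w = after a (after c w).
Proof.
rewrite /after revK mem_rev -[c \in w]mem_rev => cw ac.
by rewrite (before_before cw ac).
Qed.

Definition firstlast a w := (a \in w) && (walpha w == a |: walpha (before a w)).

Lemma firstlastP w : w != [::] -> exists a, firstlast a w.
Proof.
elim/last_ind: w => // w x IHw _; have [xw|xw] := boolP (x \in w).
  have [|a /andP[aw /eqP e]] := IHw; first by case: (w) xw.
  exists a; rewrite /firstlast -cats1 before_cat aw mem_cat aw /= -e walpha_cat.
  by apply/eqP/setUidPl/subsetP=> b; rewrite !inE => /eqP->.
exists x; rewrite /firstlast -cats1 mem_cat mem_head orbT /= before_cat.
rewrite (negPf xw) /before /= eqxx cats0 walpha_cat setUC.
by apply/eqP; congr (_ :|: _); apply/setP=> b; rewrite !inE.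
Qed.

Lemma firstlastD a w :
  firstlast a w -> walpha w :\: walpha (before a w) = [set a].
Proof.
case/andP=> _ /eqP->; have := before_notin a w; set p := before a w => ap.
by apply/setP=> b; rewrite !inE; case: eqVneq => [->|_] /=; rewrite ?ap ?andNb.
Qed.

Lemma card_firstlast a w :
  firstlast a w -> #|walpha w| = #|walpha (before a w)|.+1.
Proof.
by case/andP=> _ /eqP->; rewrite cardsU1 inE before_notin.
Qed.

Lemma maxpref_before a w : firstlast a w -> maxpref w = before a w.
Proof.
move=> fl; case/andP: (fl) => aw /eqP e; rewrite /maxpref /before.
congr (take _ w); apply/eqP; rewrite eqn_leq; apply/andP; split.
  apply/bigmax_leqP => k; apply: contraTT; rewrite -ltnNge => ltk.
  suff ->: walpha (take k w) = walpha w by rewrite setDv cards0.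
  apply/eqP; rewrite eqEsubset; apply/andP; split.
    by apply/subsetP=> b; rewrite !inE; apply: mem_take.
  rewrite e; apply/subsetP=> b; rewrite !inE /before => /orP[/eqP->|].
    by rewrite in_take_leq // -ltnS.
  by rewrite -(take_takel _ (ltnW ltk)); apply: mem_take.
have lti : index a w < (size w).+1 by rewrite ltnS index_size.
apply: (bigmax_sup (Ordinal lti)) => //=.
by rewrite (firstlastD fl) cards1.
Qed.

Lemma maxsuff_after a w : firstlast a (rev w) -> maxsuff w = after a w.
Proof. by move=> fl; rewrite /maxsuff (maxpref_before fl). Qed.

Lemma sole1 x a : sole x [set a] = a.
Proof. by rewrite /sole; case: pickP => [b /set1P|/(_ a)] //; rewrite set11. Qed.

Definition ptrw w := ptr #|walpha w| w.

Lemma ptrwE a b w : firstlast a w -> firstlast b (rev w) ->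
  ptrw w = Node (ptrw (before a w)) a b (ptrw (after b w)).
Proof.
move=> fa fb; have ca := card_firstlast fa; have cb := card_firstlast fb.
have ptrS k : exists x, ptr k.+1 w =
    Node (ptr k (maxpref w)) (sole x (walpha w :\: walpha (maxpref w)))
         (sole x (walpha w :\: walpha (maxsuff w))) (ptr k (maxsuff w)).
  by case: (w) fa => [//|x w' _]; exists x.
have Db : walpha w :\: walpha (maxsuff w) = [set b].
  by rewrite (maxsuff_after fb) -(firstlastD fb) !walpha_rev.
rewrite {1}/ptrw ca; have [x ->] := ptrS #|walpha (before a w)|.
rewrite (maxpref_before fa) (firstlastD fa).
rewrite Db (maxsuff_after fb) !sole1; congr (Node _ _ _ (ptr _ _)).
by apply/eqP; rewrite -eqSS -ca -(walpha_rev w) cb walpha_rev.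
Qed.

Lemma ptrw_node w : w != [::] -> exists a b,
  [/\ firstlast a w, firstlast b (rev w)
    & ptrw w = Node (ptrw (before a w)) a b (ptrw (after b w))].
Proof.
move=> w0; have [a fa] := firstlastP w0.
have [|b fb] := @firstlastP (rev w).
  by rewrite -size_eq0 size_rev size_eq0.
by exists a, b; split=> //; apply: ptrwE.
Qed.

Lemma ptrwP w : istree (ptrw w) /\ palpha (ptrw w) = walpha w.
Proof.
have [d] := ubnP #|walpha w|; elim: d w => // d IHd w ltd.
have [->|/ptrw_node[a [b [fa fb ->]]]] := eqVneq w [::].
  rewrite /ptrw; have /eqP->: #|@walpha [::]| == 0 by rewrite walpha0.
  by split=> //; apply/setP=> c; rewrite !inE.
have [|i0 e0] := IHd (before a w); first by rewrite -ltnS -(card_firstlast fa).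
have [|i1 e1] := IHd (after b w).
  by rewrite walpha_rev -ltnS -(card_firstlast fb) walpha_rev.
rewrite /= i0 i1 e0 e1 !inE before_notin after_notin /=.
case/andP: fa => _ /eqP<-; case/andP: fb => _; rewrite !walpha_rev => /eqP<-.
by rewrite eqxx.
Qed.

Lemma ptrw_istree w : istree (ptrw w). Proof. by case: (ptrwP w). Qed.
Lemma ptrw_alpha w : palpha (ptrw w) = walpha w. Proof. by case: (ptrwP w). Qed.

Definition tr w : tree n := Tree (ptrw_istree w).

Lemma ptrw_walpha w w' : ptrw w = ptrw w' -> walpha w = walpha w'.
Proof. by move=> e; rewrite -!ptrw_alpha e. Qed.

Lemma ptrw_mem w w' a : ptrw w = ptrw w' -> (a \in w) = (a \in w').
Proof. by move/ptrw_walpha/setP/(_ a); rewrite !inE. Qed.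

Lemma ptrw_nil w w' : ptrw w = ptrw w' -> (w == [::]) = (w' == [::]).
Proof. by move/ptrw_walpha=> e; rewrite -!walpha0 e. Qed.

Lemma firstlast_mem a b w :
  firstlast a w -> b \in w -> b != a -> b \in before a w.
Proof.
case/andP=> _ /eqP/setP/(_ b); rewrite !inE => -> /predU1P[->|//].
by rewrite eqxx.
Qed.

Lemma ptrw_before_after a w w' : ptrw w = ptrw w' -> a \in w ->
  ptrw (before a w) = ptrw (before a w')
  /\ ptrw (after a w) = ptrw (after a w').
Proof.
have [d] := ubnP #|walpha w|; elim: d w w' => // d IHd w w' ltd e aw.
have aw' : a \in w' by rewrite -(ptrw_mem _ e).
have w0 : w != [::] by case: (w) aw.
have w0' : w' != [::] by case: (w') aw'.
have [b [c [fb fc ew]]] := ptrw_node w0.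
have [b' [c' [fb' fc' ew']]] := ptrw_node w0'.
move: (e); rewrite ew ew' => -[eb ? ? ec]; subst b' c'.
have bw : b \in w by case/andP: fb.
have bw' : b \in w' by case/andP: fb'.
have cw : c \in w by case/andP: fc => + _; rewrite mem_rev.
have cw' : c \in w' by case/andP: fc' => + _; rewrite mem_rev.
split.
  have [->//|ab] := eqVneq a b.
  have aB := firstlast_mem fb aw ab; have aB' := firstlast_mem fb' aw' ab.
  rewrite (before_before bw aB) (before_before bw' aB').
  by case: (IHd _ _ _ eb aB); rewrite // -ltnS -(card_firstlast fb).
have [->//|ac] := eqVneq a c.
have aA : a \in after c w by rewrite mem_rev firstlast_mem ?mem_rev.
have aA' : a \in after c w' by rewrite mem_rev firstlast_mem ?mem_rev.
rewrite (after_after cw aA) (after_after cw' aA').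
case: (IHd _ _ _ ec aA) => //.
by rewrite walpha_rev -ltnS -(card_firstlast fc) walpha_rev.
Qed.

Lemma ptrw_cat u w w' v :
  ptrw w = ptrw w' -> ptrw (u ++ w ++ v) = ptrw (u ++ w' ++ v).
Proof.
have [d] := ubnP #|walpha (u ++ w ++ v)|; elim: d u w w' v => // d IHd u w w' v.
set W := u ++ w ++ v; set W' := u ++ w' ++ v => ltd e.
have eW : walpha W = walpha W' by rewrite !walpha_cat (ptrw_walpha e).
have [W0|/ptrw_node[a [b [fa fb eWn]]]] := eqVneq W [::].
  have := walpha0 W'; rewrite -eW walpha0 W0 eqxx => /esym/eqP->.
  by [].
have [aW bW] : a \in W /\ b \in W.
  by case/andP: fa fb => -> _ /andP[]; rewrite mem_rev => ->.
have ltA : #|walpha (before a W)| < d by rewrite -ltnS -(card_firstlast fa).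
have ltB : #|walpha (after b W)| < d.
  by rewrite walpha_rev -ltnS -(card_firstlast fb) walpha_rev.
have eA : ptrw (before a W) = ptrw (before a W').
  move: ltA; rewrite /W /W' !before_cat -(ptrw_mem a e); case: ifP => // _.
  case: ifP => [aw|_] ltA; last by apply: IHd.
  have [eB _] := ptrw_before_after e aw.
  by rewrite -[before a w]cats0 -[before a w']cats0; apply: IHd; rewrite ?cats0.
have eB : ptrw (after b W) = ptrw (after b W').
  move: ltB; rewrite /W /W' !after_cat !mem_cat -(ptrw_mem b e).
  have [bv _|bv] := boolP (b \in v); first by rewrite orbT.
  rewrite orbF; case: ifP => [bw|_] ltB; last exact: IHd.
  have [_ eA'] := ptrw_before_after e bw.
  exact: (IHd [::]).
rewrite eWn eA eB; apply/esym/ptrwE.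
  case/andP: fa => _ fa; rewrite /firstlast -eW -(ptrw_walpha eA) fa andbT.
  by have /setP/(_ a) := eW; rewrite !inE aW => <-.
case/andP: fb => _; rewrite /firstlast !walpha_rev -eW => fb.
have /setP/(_ b) := eW; rewrite mem_rev !inE bW => <- /=.
by have := ptrw_walpha eB; rewrite !walpha_rev => <-.
Qed.

Definition word t : seq 'I_n := pword (tval t).

Lemma ptrw_pword (t : preTree n) :
  istree t -> walpha (pword t) = palpha t /\ ptrw (pword t) = t.
Proof.
elim: t => [|t0 IH0 a0 a1 t1 IH1] /=.
  have W0 : walpha [::] = set0 by apply/eqP; rewrite -cards_eq0 walpha0.
  by rewrite /ptrw W0 cards0.
case/and5P=> /IH0[A0 T0] /IH1[A1 T1] a0t0 a1t1 /eqP e.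
set w := pword t0 ++ _.
have a0N : a0 \notin pword t0 by rewrite -A0 inE in a0t0.
have a1N : a1 \notin pword t1 by rewrite -A1 inE in a1t1.
have Aw : walpha w = a0 |: palpha t0.
  apply/setP=> c; have /setP/(_ c) := e; rewrite -A0 -A1 !inE mem_cat !inE => e'.
  by rewrite -e'; case: (c == a0); case: (c \in pword t0).
have Ew : w = (pword t0 ++ [:: a0; a1]) ++ pword t1 by rewrite -catA.
have B0 : before a0 w = pword t0.
  by rewrite before_cat (negPf a0N) /before /= eqxx cats0.
have B1 : after a1 w = pword t1.
  rewrite Ew after_cat (negPf a1N) after_cat !inE eqxx orbT.
  by rewrite /after /before /= eqxx.
split=> //; rewrite (@ptrwE a0 a1) ?B0 ?B1 ?T0 ?T1 //.
  by rewrite /firstlast B0 Aw A0 mem_cat mem_head orbT eqxx.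
rewrite /firstlast mem_rev walpha_rev Aw e -A1 -B1 walpha_rev eqxx andbT.
by rewrite mem_cat !inE eqxx !orbT.
Qed.

Lemma wordK : cancel word tr.
Proof. by move=> t; apply/val_inj; case: (ptrw_pword (valP t)). Qed.

(* As tr is surjective (wordK), this is the only operation for which tr is a
   morphism (trM). *)
Definition tmul t u : tree n := tr (word t ++ word u).

Lemma tr_mul v w : tr (v ++ w) = tmul (tr v) (tr w).
Proof.
apply/val_inj; rewrite /=.
have trK u : ptrw (word (tr u)) = ptrw u := congr1 val (wordK (tr u)).
rewrite -(ptrw_cat [::] w (trK v)) /=.
by have := ptrw_cat (word (tr v)) [::] (trK w); rewrite !cats0.
Qed.

Lemma tmulA : associative tmul.
Proof.
by move=> t u v; rewrite -[t]wordK -[u]wordK -[v]wordK -!tr_mul catA.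
Qed.

Lemma tmul1t : left_id (tr [::]) tmul.
Proof. by move=> t; rewrite -[t]wordK -tr_mul. Qed.

Lemma tmult1 : right_id (tr [::]) tmul.
Proof. by move=> t; rewrite -[t]wordK -tr_mul cats0. Qed.

HB.instance Definition _ :=
  isMonoid.Build (tree n) tmulA tmul1t tmult1.

Lemma trM v w : tr (v ++ w) = (tr v * tr w)%g.
Proof. exact: tr_mul. Qed.

End Tree.

Section Replete.
Variable n : nat.
Implicit Types (x y t : tree n) (S U : {set tree n}) (A : {set 'I_n}).

Definition subsemigroup U : bool :=
  [forall x in U, forall y in U, (x * y)%g \in U].

Definition residual x S y : {set tree n} := [set t | (x * t * y)%g \in S].

Definition replete S : bool :=
  [forall x, forall y, subsemigroup (residual x S y)].

Definition alphas U : {set {set 'I_n}} := [set alpha t | t in U].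

Definition withAlpha U A : {set tree n} := [set t in U | alpha t == A].

Definition lmps U : {fset seq 'I_n} := [fset lmp t | t in U]%fset.
Definition rmps U : {fset seq 'I_n} := [fset rmp t | t in U]%fset.

Definition alphas_m S : {set {set 'I_n}} :=
  [set A in alphas S | [&& minset [in alphas S] A,
     #|` lmps (withAlpha S A)| == 1 & #|` rmps (withAlpha S A)| == 1]].

End Replete.

(* Main.v *)
From mathcomp Require Import all_boot all_algebra.
From mathcomp Require Import finmap multiset boolp.
Require Import Defs.

(** The elements of the free mirig are finite sums of trees.  In a band a word
is the product of its shortest prefix and its shortest suffix with all its
letters, so by induction two words with the same tree have the same value in
every mirig [band_ptrw].  An element of the free mirig is therefore the value
of a finite list of trees, and the problem is to decide when two lists have
the same value.  Three invariants do it.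

- The replete subsemigroup S generated by the entries of the list.
- The solo trees: those entries t such that t itself is the only entry,
  multiplicity included, whose alphabet lies in that of t.
- The set of the alphabets carried by an odd number of entries.

They are invariants [mirigCong_same_data] because the number of entries with
alphabet inside A is additive and multiplicative in the list, so that modulo
r = r * r it survives up to 2 = 4; because containment of the entries in a
replete subsemigroup can be tested one factor at a time; and because a product
is solo exactly when it is the unique product available, hence a product of
solo trees.

They are complete [value_data].  Expanding (u + v) * (u + v) = u + v between p
and q shows that p u q + p v q absorbs 2 p u v q, since 4 = 2 in a mirig.  So
the trees t with r = r + 2 t form a replete subsemigroup [absorbs_rclosed]. An
entry t that does not have the alphabet of a solo tree sits next to an entry u
with alphabet inside that of t, and then t u and t = (t u) t are both absorbed.
The property [governed] carries this on to every tree of S whose alphabet is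
not that of a solo tree.  Once all these 2 t are present, sums of such trees
form a group of exponent 2 in which trees with the same alphabet commute; they
are then equal, since t = t (u t) and u t = (u t) t, and only the parities
remain.

Every consistent choice of invariants is realized [admissible_data].  The key
is that a replete subsemigroup contains, with a tree t, all trees that have the
leftmost and the rightmost path of t [rclosed_saturated]; conversely all trees
with given paths form a replete subsemigroup.  Hence E, the set of the
alphabets of solo trees, is any subset of the minimal alphabets A for which S_A
has one leftmost and one rightmost path; for A in E the solo tree is any
element of S_A, that is, any tree with the two given paths; and the odd
alphabets are any set between E and all the alphabets of S, which gives the
power of 2.  The trees with two given paths are counted by recursion on the
alphabet [card_lmp_rmp]. *)

Import GRing.Theory.

Set Implicit Arguments.
Unset Strict Implicit.
Unset Printing Implicit Defensive.

(** * Words in a band *)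

Section BandWord.
Variables (n : nat) (M : Type) (op : M -> M -> M) (phi : seq 'I_n -> M).
Hypotheses (opA : associative op) (opxx : idempotent_op op).
Hypothesis phiM : {morph phi : u v / u ++ v >-> op u v}.
Implicit Types (u v w : seq 'I_n) (a b : 'I_n).

(** From x = s y t one gets x (y t) = x, so x and x y generate the same right
ideal; this is where x y x = x comes from. *)
Lemma band_absorb x s y t : x = op s (op y t) -> op x (op y x) = x.
Proof.
move=> ex; have xyt : op x (op y t) = x by rewrite {1}ex -opA opxx -ex.
by rewrite -{2}xyt !opA -(opA (op x y) x y) opxx -opA xyt.
Qed.

(** Words with the same letters lie in a rectangular band.  The induction peels
off the first letter c of u, with w c in place of w, because w c w = w. *)
Lemma band_sandwich u w :
  walpha u \subset walpha w -> phi (w ++ u ++ w) = phi w.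
Proof.
elim: u w => [|c u IHu] w uw; first by rewrite phiM opxx.
have cw : c \in w by have /subsetP/(_ c) := uw; rewrite !inE eqxx; apply.
have wcw : op (phi w) (op (phi [:: c]) (phi w)) = phi w.
  case/splitPr: w / cw {uw} => s t.
  by apply: (@band_absorb _ (phi s) _ (phi t)); rewrite -!phiM.
have /IHu: walpha u \subset walpha (w ++ [:: c]).
  apply/subsetP=> b bu; move/subsetP/(_ b): uw; move: bu.
  by rewrite !inE mem_cat => -> /(_ (orbT _)) ->.
rewrite !phiM => e; rewrite -(cat1s c u) (phiM [:: c]).
have -> : op (phi w) (op (op (phi [:: c]) (phi u)) (phi w))
    = op (op (op (phi w) (phi [:: c])) (op (phi u) (op (phi w) (phi [:: c]))))
         (phi w) by rewrite -!opA wcw.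
by rewrite e -opA.
Qed.

(** In a rectangular band the middle factors of a product do not matter. *)
Lemma band_drop u v w :
  walpha v \subset walpha u -> walpha u = walpha w ->
  phi (u ++ v ++ w) = phi (u ++ w).
Proof.
move=> vu uw.
have w_uw : phi w = op (phi w) (op (phi u) (phi w)).
  by rewrite -!phiM band_sandwich // uw.
rewrite !phiM w_uw.
have -> : op (phi u) (op (phi v) (op (phi w) (op (phi u) (phi w))))
          = op (op (phi u) (op (op (phi v) (phi w)) (phi u))) (phi w).
  by rewrite !opA.
have -> : op (phi u) (op (op (phi v) (phi w)) (phi u)) = phi u.
  by rewrite -!phiM band_sandwich // walpha_cat subUset vu uw /=.
by rewrite -w_uw.
Qed.

(** Squaring w puts its shortest full prefix first and its shortest full suffix
last, and what lies between them can be dropped. *)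
Lemma band_firstlast a b w : firstlast a w -> firstlast b (rev w) ->
  phi w = op (op (phi (before a w)) (phi [:: a]))
             (op (phi [:: b]) (phi (after b w))).
Proof.
move=> /andP[/beforeP[w1 e1] /eqP A1] /andP[/beforeP[w2 e2] /eqP A2].
have e2' : w = rev w2 ++ b :: after b w.
  by rewrite -[LHS]revK e2 rev_cat rev_cons cat_rcons.
set p := before a w in e1 A1 *; set q := after b w in e2' *.
have Ap : walpha (p ++ [:: a]) = walpha w.
  by rewrite A1 walpha_cat setUC; congr (_ :|: _); apply/setP=> c; rewrite !inE.
have Aq : walpha ([:: b] ++ q) = walpha w.
  rewrite -[RHS]walpha_rev A2 walpha_cat /q /after walpha_rev.
  by congr (_ :|: _); apply/setP=> c; rewrite !inE.
have -> : phi w = phi ((p ++ [:: a]) ++ (w1 ++ rev w2) ++ ([:: b] ++ q)).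
  by rewrite -[LHS]opxx -phiM {1}e1 {1}e2' -!catA.
rewrite band_drop ?Ap ?Aq ?phiM //.
apply/subsetP=> c; rewrite !inE mem_cat => /orP[c1|c2].
  by rewrite e1 mem_cat in_cons c1 !orbT.
by rewrite e2' mem_cat c2.
Qed.

(** The part of the solution of the word problem for free bands that says that
trees are a complete invariant. *)
Lemma band_ptrw w w' : ptrw w = ptrw w' -> phi w = phi w'.
Proof.
have [d] := ubnP #|walpha w|; elim: d w w' => // d IHd w w' ltd e.
have [w0|w0] := eqVneq w [::].
  by have := ptrw_nil e; rewrite w0 eqxx => /esym/eqP->.
have w0' : w' != [::] by rewrite -(ptrw_nil e).
have [a [b [fa fb ew]]] := ptrw_node w0.
have [a' [b' [fa' fb' ew']]] := ptrw_node w0'.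
move: e; rewrite ew ew' => -[ea ? ? eb]; subst a' b'.
rewrite (band_firstlast fa fb) (band_firstlast fa' fb').
rewrite (IHd _ _ _ ea) ?(IHd _ _ _ eb) //.
  by rewrite walpha_rev -ltnS -(card_firstlast fb) walpha_rev.
by rewrite -ltnS -(card_firstlast fa).
Qed.

End BandWord.

(** * The band of trees *)

(** [undup] keeps last occurrences, so it computes the rightmost path of a word,
and the leftmost path after reversal. *)
Section Undup.
Variable T : eqType.
Implicit Types p q r s w z : seq T.

Lemma undup_catr w (w1 w2 : seq T) :
  undup w1 = undup w2 -> undup (w ++ w1) = undup (w ++ w2).
Proof.
move=> e; rewrite !undup_cat e; congr (_ ++ _); apply: eq_filter => c.
by rewrite -mem_undup e mem_undup.
Qed.

Lemma undup_absorb (w1 w2 : seq T) : {subset w1 <= w2} -> undup (w1 ++ w2) =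
  undup w2.
Proof.
move=> sub; rewrite undup_cat (@eq_in_filter _ _ pred0) ?filter_pred0 // => c.
by rewrite mem_undup => /sub ->.
Qed.

Lemma cat_suffix (s1 s2 w1 w2 : seq T) :
  s1 ++ w1 = s2 ++ w2 -> size w1 <= size w2 -> exists z, w2 = z ++ w1.
Proof.
move=> e le12; exists (drop (size s2) s1).
have le21 : size s2 <= size s1.
  have := congr1 size e; rewrite !size_cat => es.
  by rewrite -(leq_add2r (size w1)) es leq_add2l.
rewrite -[w2](drop_size_cat _ (erefl (size s2))) -e drop_cat.
move: le21; rewrite leq_eqVlt => /predU1P[->|->//].
by rewrite ltnn subnn drop0 drop_size.
Qed.

(** The last occurrences in q ++ w and in r ++ w are both final segments of the
same list; the longer of the two absorbs the shorter. *)
Lemma undup_insert p q r w :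
  undup (p ++ q ++ w) = undup (p ++ r ++ w) ->
  undup (p ++ q ++ r ++ w) = undup (p ++ q ++ w).
Proof.
move=> e; have e1 := e; rewrite !(undup_cat p) in e1.
have [leXY|leYX] := leqP (size (undup (q ++ w))) (size (undup (r ++ w))).
  have [z ez] := cat_suffix e1 leXY.
  rewrite e; apply: undup_catr; apply: undup_absorb => c cq.
  by rewrite -mem_undup ez mem_cat !mem_undup mem_cat cq orbT.
have [z ez] := cat_suffix (esym e1) (ltnW leYX).
apply: undup_catr; rewrite ez undup_cat; congr (_ ++ _).
have zY : ~~ has [in z] (undup (r ++ w)).
  by have := undup_uniq (q ++ w); rewrite ez cat_uniq => /and3P[].
have out s : {subset s <= r ++ w} -> filter [predC r ++ w] s = [::].
  move=> sub; rewrite -(filter_pred0 s); apply: eq_in_filter => c /sub /= cs.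
  by rewrite cs.
(* Removing the letters of r ++ w from both sides of ez isolates z. *)
have := congr1 (filter [predC r ++ w]) ez.
rewrite (undup_cat q) !filter_cat -filter_predI.
rewrite (out (undup w)) ?(out (undup (r ++ w))) ?cats0 => [ef|c|c]; last first.
- by rewrite mem_undup mem_cat => ->; rewrite orbT.
- by rewrite mem_undup.
have zE : filter [predC r ++ w] z = z.
  apply/all_filterP/allP => c cz /=; apply: contra zY => cY.
  by apply/hasP; exists c => //; rewrite mem_undup.
rewrite -[RHS]zE -ef; apply: eq_filter => c.
by rewrite /= !mem_cat; case: (c \in w); rewrite ?orbT ?andbT.
Qed.

End Undup.

Section TreeBand.
Variable n : nat.
Implicit Types (s t u v x y : tree n) (w : seq 'I_n) (a b : 'I_n).
Local Open Scope group_scope.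

Lemma alpha_tr w : alpha (tr w) = walpha w.
Proof. exact: ptrw_alpha. Qed.

Lemma alpha_word t : walpha (word t) = alpha t.
Proof. by rewrite -{2}[t]wordK alpha_tr. Qed.

Lemma alphaM t u : alpha (t * u) = alpha t :|: alpha u.
Proof. by rewrite [t * u]/(tr _) alpha_tr walpha_cat !alpha_word. Qed.

Lemma firstlast_catxx a w : firstlast a w -> firstlast a (w ++ w).
Proof.
rewrite /firstlast before_cat mem_cat walpha_cat setUid.
by case/andP=> -> ->.
Qed.

Lemma tr_catxx w : tr (w ++ w) = tr w.
Proof.
apply/val_inj => /=; have [->//|/ptrw_node[a [b [fa fb ->]]]] := eqVneq w [::].
rewrite (ptrwE (b := b) (firstlast_catxx fa)); last first.
  by rewrite rev_cat firstlast_catxx.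
have [aw _] := andP fa; have [bw _] := andP fb; rewrite mem_rev in bw.
by rewrite before_cat after_cat aw bw.
Qed.

Lemma tmulxx t : t * t = t.
Proof. by rewrite -[t]wordK -trM tr_catxx. Qed.

Lemma tree_sandwich t u : alpha u \subset alpha t -> t * u * t = t.
Proof.
rewrite -[t]wordK -[u]wordK !alpha_tr -!trM -catA => ut.
by apply: (band_sandwich (op := fun x y => x * y) _ _ (@trM n)) => //;
  [exact: mulgA | exact: tmulxx].
Qed.

Lemma tree_drop t u v :
  alpha u \subset alpha t -> alpha t = alpha v -> t * u * v = t * v.
Proof.
rewrite -[t]wordK -[u]wordK -[v]wordK !alpha_tr -!trM -catA => ut tv.
by apply: (band_drop (op := fun x y => x * y) _ _ (@trM n)) => //;
  [exact: mulgA | exact: tmulxx].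
Qed.

Lemma rmp_tr w : rmp (tr w) = undup w.
Proof.
rewrite /rmp /=; have [d] := ubnP #|walpha w|; elim: d w => // d IHd w ltd.
have [->|/ptrw_node[a [b [fa fb ->]]]] := eqVneq w [::].
  by rewrite /ptrw; have := @walpha0 n [::]; rewrite eqxx => /eqP->.
rewrite /= IHd; last by rewrite walpha_rev -ltnS -(card_firstlast fb)
  walpha_rev.
have [bw /eqP e] := andP fb; have [w2 e2] := beforeP bw.
have e2' : w = rev w2 ++ b :: after b w.
  by rewrite -[LHS]revK e2 rev_cat rev_cons cat_rcons.
have -> : undup w = undup (b :: after b w).
  rewrite {1}e2' undup_cat (@eq_in_filter _ _ pred0) ?filter_pred0 // => c.
  rewrite mem_undup mem_rev => cw2; apply/negbTE; rewrite negbK in_cons mem_rev.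
  have : c \in walpha (rev w) by rewrite inE e2 mem_cat in_cons cw2 !orbT.
  by rewrite e !inE.
by rewrite /= (negPf (after_notin _ _)).
Qed.

Lemma lmp_tr w : lmp (tr w) = rev (undup (rev w)).
Proof.
rewrite /lmp /=; have [d] := ubnP #|walpha w|; elim: d w => // d IHd w ltd.
have [->|/ptrw_node[a [b [fa fb ->]]]] := eqVneq w [::].
  by rewrite /ptrw; have := @walpha0 n [::]; rewrite eqxx => /eqP->.
rewrite /= IHd; last by rewrite -ltnS -(card_firstlast fa).
have [aw /eqP e] := andP fa; have [w2 e2] := beforeP aw.
rewrite -rev_cons; congr rev.
have -> : undup (rev w) = undup (a :: rev (before a w)).
  rewrite {1}e2 rev_cat rev_cons cat_rcons undup_cat.
  rewrite (@eq_in_filter _ _ pred0) ?filter_pred0 // => c.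
  rewrite mem_undup mem_rev => cw2; apply/negbTE; rewrite negbK in_cons mem_rev.
  have : c \in walpha w by rewrite inE e2 mem_cat in_cons cw2 !orbT.
  by rewrite e !inE.
by rewrite /= mem_rev (negPf (before_notin _ _)).
Qed.

End TreeBand.

(** * Replete subsemigroups and paths *)

Section Closed.
Variable n : nat.
Implicit Types (s t u v x y : tree n) (w : seq 'I_n) (a b c : 'I_n).
Implicit Types (H : tree n -> Prop) (S X : {set tree n}).
Local Open Scope group_scope.

(** A replete subsemigroup, as a predicate: x = y = 1 gives closure under
products.  Predicates allow for sets defined by equations in the free mirig. *)
Definition rclosed H : Prop := forall x y u v,
  H (x * u * y) -> H (x * v * y) -> H (x * (u * v) * y).

Lemma rclosedP S :
  reflect (rclosed (fun t => t \in S)) (subsemigroup S && replete S).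
Proof.
apply: (iffP andP) => [[_ /forallP repS] x y u v xu xv | clS].
  have /forall_inP/(_ u) := forallP (repS x) y; rewrite inE => /(_ xu).
  by move/forall_inP/(_ v); rewrite !inE; apply.
split.
  apply/forall_inP => u uS; apply/forall_inP => v vS.
  by rewrite -[u * v]mul1g -[1 * _]mulg1; apply: clS; rewrite !(mul1g, mulg1).
apply/forallP => x; apply/forallP => y.
apply/forall_inP => u; rewrite inE => uS; apply/forall_inP => v.
by rewrite !inE => vS; apply: clS.
Qed.

Lemma rclosedM H u v : rclosed H -> H u -> H v -> H (u * v).
Proof.
by move=> /(_ 1 1 u v); rewrite !(mul1g, mulg1).
Qed.

Lemma rclosed_residual H x y : rclosed H -> rclosed (fun t => H (x * t * y)).
Proof.
by move=> clH x' y' u v; have := clH (x * x') (y' * y) u v; rewrite !mulgA.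
Qed.

Lemma mem_lmp t : lmp t =i alpha t.
Proof.
by move=> c; rewrite -[t]wordK lmp_tr alpha_tr inE mem_rev mem_undup mem_rev.
Qed.

Lemma mem_rmp t : rmp t =i alpha t.
Proof. by move=> c; rewrite -[t]wordK rmp_tr alpha_tr inE mem_undup. Qed.

Lemma lmp_alpha t u : lmp t = lmp u -> alpha t = alpha u.
Proof. by move=> e; apply/setP => c; rewrite -!mem_lmp e. Qed.

Lemma rmp_alpha t u : rmp t = rmp u -> alpha t = alpha u.
Proof. by move=> e; apply/setP => c; rewrite -!mem_rmp e. Qed.

Lemma rmpM t u : alpha t \subset alpha u -> rmp (t * u) = rmp u.
Proof.
rewrite -[t]wordK -[u]wordK !alpha_tr -trM !rmp_tr => /subsetP tu.
by apply: undup_absorb => c; have := tu c; rewrite !inE.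
Qed.

Lemma lmpM t u : alpha u \subset alpha t -> lmp (t * u) = lmp t.
Proof.
rewrite -[t]wordK -[u]wordK !alpha_tr -trM !lmp_tr => /subsetP tu.
rewrite rev_cat undup_absorb // => c.
by have := tu c; rewrite !inE !mem_rev.
Qed.

Lemma rclosed_rmp r : rclosed (fun t => rmp t = r).
Proof.
move=> x y u v; rewrite -[x]wordK -[y]wordK -[u]wordK -[v]wordK -!trM !rmp_tr.
by rewrite -!catA => <- e; apply: undup_insert; rewrite e.
Qed.

Lemma rclosed_lmp r : rclosed (fun t => lmp t = r).
Proof.
move=> x y u v; rewrite -[x]wordK -[y]wordK -[u]wordK -[v]wordK -!trM !lmp_tr.
rewrite !rev_cat -!catA => <- /(can_inj revK) e; congr rev.
by rewrite -e; apply: undup_insert.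
Qed.

Definition gen a : tree n := tr [:: a].

Lemma alpha_gen a : alpha (gen a) = [set a].
Proof. by rewrite alpha_tr; apply/setP => c; rewrite !inE. Qed.

Lemma alpha1 : alpha (1 : tree n) = set0.
Proof.
by rewrite (_ : 1 = tr [::]) // alpha_tr; apply/setP => c; rewrite !inE.
Qed.

Lemma alpha_eq0 t : (alpha t == set0) = (t == 1).
Proof.
apply/eqP/eqP => [t0|->]; last exact: alpha1.
rewrite -[t]wordK (_ : word t = [::]) //.
by apply/eqP; rewrite -walpha0 alpha_word t0 cards0.
Qed.

Variant tree_spec t : Type :=
| TreeOne of t = 1
| TreeNode t0 a b t1 of t = t0 * gen a * gen b * t1
    & a \notin alpha t0 & b \notin alpha t1
    & a |: alpha t0 = alpha t & b |: alpha t1 = alpha t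
    & lmp t = rcons (lmp t0) a & rmp t = b :: rmp t1.

Lemma treeP t : tree_spec t.
Proof.
case: t => -[|p0 a b p1] i.
  by left; apply/eqP; rewrite -alpha_eq0.
have /and5P[i0 i1 a0 b1 /eqP e] := i.
apply: (@TreeNode _ (Tree i0) a b (Tree i1)) => //.
rewrite -[LHS]wordK -[in RHS](wordK (Tree i0)) -[in RHS](wordK (Tree i1)).
by rewrite /gen -!trM -!catA.
Qed.

(** Induction on the alphabet, with H universally quantified so that it can be
replaced by its residuals.  Write t = t0 a b t1.  The left half t0 can be
replaced by t0 s0, which has the leftmost path of t0 and the rightmost path of
s0, because t0 [s0] t0 y and t0 [a] t0 y are both equal to t0 y for y = a b t1.
In the residual by y, the induction hypothesis then leads from t0 s0 to s0.  The
right half is treated symmetrically. *)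
Lemma rclosed_saturated H s t :
  rclosed H -> lmp s = lmp t -> rmp s = rmp t -> H t -> H s.
Proof.
have [d] := ubnP #|alpha t|; elim: d H s t => // d IHd H s t ltd clH el er Ht.
have es := lmp_alpha el.
case: (treeP t) => [t1|t0 a b t1 et a0 b1 eA eB elt ert].
  by move: es; rewrite t1 alpha1 => /eqP; rewrite alpha_eq0 => /eqP->;
    rewrite -t1.
case: (treeP s) => [s1|s0 a' b' s1 es' a0' b1' eA' eB' els ers].
  by move/setP/(_ a): eA; rewrite -es s1 alpha1 !inE eqxx.
move: el er; rewrite els ers elt ert => /rcons_inj[e0 ?] [? e1]; subst a' b'.
have l0 : #|alpha t0| < d by rewrite -ltnS; apply: leq_trans ltd;
  rewrite -eA cardsU1 a0.
have l1 : #|alpha t1| < d by rewrite -ltnS; apply: leq_trans ltd;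
  rewrite -eB cardsU1 b1.
have A0 := lmp_alpha e0; have A1 := rmp_alpha e1.
have Abt : alpha (gen b * t1) = alpha t by rewrite alphaM alpha_gen.
have Aat : alpha (t0 * gen a) = alpha t by rewrite alphaM alpha_gen setUC.
have Aas : alpha (s0 * gen a) = alpha t by rewrite alphaM alpha_gen setUC A0.
have Abs : alpha (gen b * s1) = alpha t by rewrite alphaM alpha_gen A1.
have Ats : alpha (t0 * (s0 * gen a)) = alpha t.
  by rewrite alphaM Aas; apply/setUidPr; rewrite -eA subsetUr.
have Asb : alpha (gen b * s1 * t1) = alpha t.
  by rewrite alphaM Abs; apply/setUidPl; rewrite -eB subsetUr.
(* Insert s0 and a between two copies of t0. *)
have Hl : H (s0 * (gen a * (gen b * t1))).
  have Hy : H (t0 * (gen a * (gen b * t1))) by rewrite !mulgA -et.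
  set y := gen a * (gen b * t1) in Hy *.
  suff: (fun z => H (1 * z * y)) s0 by rewrite mul1g.
  apply: (IHd _ s0 (t0 * s0) _ (rclosed_residual (x := 1) (y := y) clH)).
  - by rewrite alphaM A0 setUid.
  - by rewrite lmpM // A0.
  - by rewrite rmpM // A0.
  have -> : 1 * (t0 * s0) * y = t0 * (s0 * gen a) * (t0 * y).
    rewrite mul1g (_ : t0 * (s0 * gen a) * (t0 * y) =
       (t0 * (s0 * gen a)) * (t0 * gen a) * (gen b * t1));
         last by rewrite !mulgA.
    by rewrite tree_drop ?Aat ?Ats ?Abt // !mulgA.
  apply: clH.
    by rewrite mulgA tree_sandwich ?A0.
  have -> : t0 * gen a * (t0 * y) =
      (t0 * gen a) * (t0 * gen a) * (gen b * t1) by rewrite !mulgA.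
  by rewrite tmulxx -mulgA.
(* Insert b and s1 between two copies of t1. *)
set x := s0 * gen a * gen b.
suff: (fun z => H (x * z * 1)) s1 by rewrite mulg1 es'.
apply: (IHd _ s1 (s1 * t1) _ (rclosed_residual (x := x) (y := 1) clH)).
- by rewrite alphaM A1 setUid.
- by rewrite lmpM // A1.
- by rewrite rmpM // A1.
have -> : x * (s1 * t1) * 1 = x * t1 * (gen b * s1) * t1.
  rewrite mulg1 (_ : x * t1 * (gen b * s1) * t1 =
    (s0 * gen a) * (gen b * t1) * (gen b * s1 * t1)); last by rewrite !mulgA.
  by rewrite tree_drop ?Aas ?Abt ?Asb // !mulgA.
apply: clH.
  rewrite (_ : x * t1 * gen b * t1 =
    s0 * gen a * ((gen b * t1) * (gen b * t1))).
    by rewrite tmulxx !mulgA in Hl *.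
  by rewrite !mulgA.
rewrite -mulgA -mulgA (mulgA t1) tree_sandwich ?A1 //.
by rewrite !mulgA in Hl.
Qed.

End Closed.

(** * Invariants of the free mirig *)

(** Equality in the quotient of the rig of natural numbers by 2 = 4, the largest
quotient in which every element is idempotent. *)
Definition same_2eq4 k l : bool :=
  [&& odd k == odd l, (k == 0) == (l == 0) & (k == 1) == (l == 1)].

Lemma same_2eq4_add k k' l l' :
  same_2eq4 k k' -> same_2eq4 l l' -> same_2eq4 (k + l) (k' + l').
Proof.
move=> /and3P[/eqP ok /eqP k0 /eqP k1] /and3P[/eqP ol /eqP l0 /eqP l1].
by rewrite /same_2eq4 !oddD ok ol !addn_eq0 k0 l0 !addn_eq1 k0 k1 l0 l1 !eqxx.
Qed.

Lemma same_2eq4_mul k k' l l' :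
  same_2eq4 k k' -> same_2eq4 l l' -> same_2eq4 (k * l) (k' * l').
Proof.
move=> /and3P[/eqP ok /eqP k0 /eqP k1] /and3P[/eqP ol /eqP l0 /eqP l1].
by rewrite /same_2eq4 !oddM ok ol !muln_eq0 k0 l0 !muln_eq1 k1 l1 !eqxx.
Qed.

Lemma same_2eq4_sqr k : same_2eq4 k (k * k).
Proof. by rewrite /same_2eq4 oddM muln_eq0 muln_eq1 andbb orbb andbb !eqxx. Qed.

Section Data.
Variable n : nat.
Implicit Types (t u v : tree n) (s : seq (tree n)) (A B : {set 'I_n}).
Implicit Types (H : tree n -> Prop) (S X Y : {set tree n}) (x y : freeRig n).

Definition rclosure X : {set tree n} :=
  \bigcap_(S : {set tree n} | [&& subsemigroup S, replete S & X \subset S]) S.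

Lemma rclosed_rclosure X : rclosed (fun t => t \in rclosure X).
Proof.
move=> x y u v /bigcapP xu /bigcapP xv; apply/bigcapP => S SP.
have /and3P[ssS rS _] := SP.
have /rclosedP clS : subsemigroup S && replete S by rewrite ssS.
by apply: clS; [apply: xu | apply: xv].
Qed.

Lemma sub_rclosure X : X \subset rclosure X.
Proof. by apply/bigcapsP => S /and3P[]. Qed.

Lemma rclosure_min H X : rclosed H -> {in X, forall t, H t} ->
  {in rclosure X, forall t, H t}.
Proof.
move=> clH XH t /bigcapP/(_ [set u | `[< H u >]]); rewrite andbA => tH.
suff /tH: (subsemigroup [set u | `[< H u >]] && replete [set u | `[< H u >]])
    && (X \subset [set u | `[< H u >]]) by rewrite inE => /asboolP.
apply/andP; split; last by apply/subsetP => u /XH Hu; rewrite inE;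
  apply/asboolP.
apply/rclosedP => x y u v; rewrite !inE => /asboolP xu /asboolP xv.
by apply/asboolP/clH.
Qed.

Lemma rclosure_eq X Y : (forall H, rclosed H ->
    {in X, forall t, H t} <-> {in Y, forall t, H t}) -> rclosure X = rclosure Y.
Proof.
move=> XY.
have XcY : {in X, forall t, t \in rclosure Y}.
  by apply/(XY _ (@rclosed_rclosure Y)) => t; apply/subsetP/sub_rclosure.
have YcX : {in Y, forall t, t \in rclosure X}.
  by apply/(XY _ (@rclosed_rclosure X)) => t; apply/subsetP/sub_rclosure.
apply/setP => t; apply/idP/idP.
  exact: (rclosure_min (@rclosed_rclosure Y) XcY).
exact: (rclosure_min (@rclosed_rclosure X) YcX).
Qed.

(** As a function of s this is a rig morphism to the natural numbers, because a
product has its letters in A iff both factors do. *)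
Definition nbelow A s := count (fun t => alpha t \subset A) s.

(** These trees survive in every list with the same value: a product that
involves another entry has letters outside t, and t is its own square. *)
Definition solo s : {set tree n} := [set t in s | nbelow (alpha t) s == 1].

Definition prods s s' : seq (tree n) := [seq (t * u)%g | t <- s, u <- s'].

Lemma nbelow_gt0 t s : t \in s -> 0 < nbelow (alpha t) s.
Proof. by move=> ts; rewrite -has_count; apply/hasP; exists t. Qed.

Lemma mem_solo t s : (t \in solo s) = (t \in s) && (nbelow (alpha t) s == 1).
Proof. by rewrite inE. Qed.

Lemma nbelow_prods A s s' : nbelow A (prods s s') = nbelow A s * nbelow A s'.
Proof.
rewrite /nbelow; elim: s => //= t s IHs.
rewrite /prods allpairs_cons count_cat -/(prods s s') IHs mulnDl; congr (_ + _).
rewrite count_map; case: (boolP (alpha t \subset A)) => tA.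
  rewrite mul1n; apply: eq_count => u /=; by rewrite alphaM subUset tA.
by rewrite mul0n -(count_pred0 s'); apply: eq_count => u /=;
  rewrite alphaM subUset (negPf tA).
Qed.

Lemma nbelow1 A s t u : nbelow A s = 1 -> t \in s -> u \in s ->
  alpha t \subset A -> alpha u \subset A -> t = u.
Proof.
rewrite /nbelow => /eqP; rewrite -size_filter => /eqP b1 ts us tA uA.
have : t \in filter (fun t => alpha t \subset A) s by rewrite mem_filter tA.
have : u \in filter (fun t => alpha t \subset A) s by rewrite mem_filter uA.
by case: filter b1 => // z [] // _; rewrite !inE => /eqP -> /eqP ->.
Qed.

Lemma nbelow_sub A B s : A \subset B -> nbelow A s <= nbelow B s.
Proof. by move=> AB; apply: sub_count => t /= /subset_trans; apply. Qed.

Lemma mem_prods t u s s' : t \in s -> u \in s' -> (t * u)%g \in prods s s'.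
Proof. by move=> ts us; apply/allpairsP; exists (t, u). Qed.

Lemma solo_cat t s s' : (t \in solo (s ++ s')) =
  (t \in solo s) && (nbelow (alpha t) s' == 0)
  || (t \in solo s') && (nbelow (alpha t) s == 0).
Proof.
rewrite !mem_solo mem_cat /nbelow count_cat -!/(nbelow _ _) addn_eq1.
have [ts|ts] := boolP (t \in s); have [ts'|ts'] := boolP (t \in s') => //=.
- have := nbelow_gt0 ts; have := nbelow_gt0 ts'.
  by case: (nbelow _ s) => [|k]; case: (nbelow _ s') => [|k'] //=;
    rewrite !andbF.
- by have := nbelow_gt0 ts; case: (nbelow _ s) => [|?] //=; rewrite !orbF.
- by have := nbelow_gt0 ts'; case: (nbelow _ s') => [|?] //=;
    rewrite ?andbF ?orbF //= andbC.
Qed.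

(** If t = u v is solo among the products then u and v are the only entries of
their lists with letters in the alphabet of t: any other choice would give
another product with alphabet inside that of t. *)
Lemma solo_prods t s s' : reflect
  (exists u v, [/\ u \in solo s, v \in solo s', t = (u * v)%g,
     nbelow (alpha t) s = 1 & nbelow (alpha t) s' = 1])
  (t \in solo (prods s s')).
Proof.
rewrite mem_solo nbelow_prods muln_eq1; apply: (iffP and3P).
  case=> /allpairsP[[u v] /= [us vs ->]] /eqP b1 /eqP b2; exists u, v.
  have uA : alpha u \subset alpha (u * v)%g by rewrite alphaM subsetUl.
  have vA : alpha v \subset alpha (u * v)%g by rewrite alphaM subsetUr.
  split; rewrite // mem_solo ?us ?vs /= eqn_leq nbelow_gt0 // andbT.
    by rewrite -b1 nbelow_sub.
  by rewrite -b2 nbelow_sub.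
case=> u [v]; rewrite !mem_solo => -[/andP[us _] /andP[vs _] -> -> ->].
by rewrite mem_prods.
Qed.

Definition trees x : seq (tree n) :=
  [seq tr w | w <- (x : {mset seq 'I_n}%mset)].

Lemma trees_add x y : perm_eq (trees (x + y)%R) (trees x ++ trees y).
Proof. by rewrite -map_cat; apply/perm_map/perm_msetD. Qed.

Lemma trees_mul x y : perm_eq (trees (x * y)%R) (prods (trees x) (trees y)).
Proof.
apply: (perm_trans (perm_map _ (perm_eq_seq_mset _))).
rewrite /prods map_allpairs allpairs_mapl allpairs_mapr.
by rewrite (eq_allpairs _ _ (fun w w' => trM w w')).
Qed.

Lemma perm_solo s s' : perm_eq s s' -> solo s = solo s'.
Proof.
move=> ss'; apply/setP => t; rewrite !mem_solo (perm_mem ss') /nbelow.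
by rewrite (permP ss').
Qed.

(** A form of the equality of the invariants that is visibly compatible with
sums and products; [same_data_eq] derives the invariants from it. *)
Definition same_data s s' := [/\ forall A, same_2eq4 (nbelow A s) (nbelow A s'),
  solo s = solo s'
  & forall H, rclosed H -> {in s, forall t, H t} <-> {in s', forall t, H t}].

Lemma perm_same_data s s' : perm_eq s s' -> same_data s s'.
Proof.
move=> ss'; split; first by move=> A;
  rewrite /nbelow (permP ss') /same_2eq4 !eqxx.
  exact: perm_solo.
by move=> H _; split=> sH t; [rewrite -(perm_mem ss') | rewrite (perm_mem ss')];
  apply: sH.
Qed.

Lemma same_data_sym s s' : same_data s s' -> same_data s' s.
Proof.
case=> b t h; split=> [A||H /h <-] //.
by have /and3P[/eqP e1 /eqP e2 /eqP e3] := b A;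
  rewrite /same_2eq4 e1 e2 e3 !eqxx.
Qed.

Lemma same_data_trans s s' s'' :
  same_data s s' -> same_data s' s'' -> same_data s s''.
Proof.
case=> b t h [b' t' h']; split=> [A||H clH]; last by rewrite h ?h'.
  have /and3P[/eqP e1 /eqP e2 /eqP e3] := b A.
  have /and3P[/eqP e1' /eqP e2' /eqP e3'] := b' A.
  by rewrite /same_2eq4 e1 e2 e3 e1' e2' e3' !eqxx.
by rewrite t.
Qed.

Lemma same_2eq4_eq0 k l : same_2eq4 k l -> (k == 0) = (l == 0).
Proof. by case/and3P => _ /eqP. Qed.

Lemma same_2eq4_eq1 k l : same_2eq4 k l -> (k == 1) = (l == 1).
Proof. by case/and3P => _ _ /eqP. Qed.

Lemma same_data_cat s1 s1' s2 s2' :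
  same_data s1 s1' -> same_data s2 s2' -> same_data (s1 ++ s2) (s1' ++ s2').
Proof.
case=> b1 t1 h1 [b2 t2 h2]; split=> [A||H clH].
- by rewrite /nbelow !count_cat; exact: same_2eq4_add (b1 A) (b2 A).
- apply/setP => t; rewrite !solo_cat t1 t2.
  by rewrite (same_2eq4_eq0 (b1 _)) (same_2eq4_eq0 (b2 _)).
have cat (s s' : seq (tree n)) : {in s ++ s', forall t, H t} <->
    {in s, forall t, H t} /\ {in s', forall t, H t}.
  split=> [sH|[sH sH'] t]; last by rewrite mem_cat => /orP[/sH|/sH'].
  by split=> t ts; apply: sH; rewrite mem_cat ts ?orbT.
by rewrite !cat h1 // h2.
Qed.

(** For the last component, the products lie in H iff each t in the first list
sends the second list into H, that is, iff the second list lies in residuals of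
H; so the two lists can be exchanged one at a time. *)
Lemma same_data_prods s1 s1' s2 s2' :
  same_data s1 s1' -> same_data s2 s2' ->
    same_data (prods s1 s2) (prods s1' s2').
Proof.
case=> b1 t1 h1 [b2 t2 h2]; split=> [A||H clH].
- by rewrite !nbelow_prods; exact: same_2eq4_mul (b1 A) (b2 A).
- apply/setP => t; apply/solo_prods/solo_prods => -[u [v]];
    rewrite ?t1 ?t2 -?t1 -?t2 => -[us vs e /eqP e1 /eqP e2]; exists u, v.
    by split=> //; apply/eqP;
      rewrite -?(same_2eq4_eq1 (b1 _)) -?(same_2eq4_eq1 (b2 _)).
  by split=> //; apply/eqP;
    rewrite ?(same_2eq4_eq1 (b1 _)) ?(same_2eq4_eq1 (b2 _)).
have dist (s s' : seq (tree n)) : {in prods s s', forall t, H t} <->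
    {in s, forall t, {in s', forall u, H (t * u)%g}}.
  split=> [sH t ts u us|sH t]; first by apply/sH/mem_prods.
  by case/allpairsP => -[u v] /= [us vs ->]; apply: sH.
have step1 t : {in s2, forall u, H (t * u)%g} <->
  {in s2', forall u, H (t * u)%g}.
  apply: (h2 (fun u => H (t * u)%g)) => x y u v.
  by have := @rclosed_residual n H t 1%g clH x y u v; rewrite !mulg1.
have step2 u : {in s1, forall t, H (t * u)%g} <->
  {in s1', forall t, H (t * u)%g}.
  apply: (h1 (fun t => H (t * u)%g)) => x y v w.
  by have := @rclosed_residual n H 1%g u clH x y v w; rewrite !mul1g.
rewrite !dist; split=> sH t ts; apply/step1 => u us; move: t ts;
  by apply/step2 => t ts; apply: sH.
Qed.

Lemma same_data_sqr s : same_data s (prods s s).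
Proof.
split=> [A||H clH].
- by rewrite nbelow_prods same_2eq4_sqr.
- apply/setP => t; apply/idP/solo_prods => [ts|].
    by exists t, t; rewrite tmulxx; split=> //; apply/eqP;
      move: ts; rewrite mem_solo => /andP[].
  case=> u [v [us vs et b1 _]]; move: us vs; rewrite !mem_solo.
  case/andP => us _ /andP[vs _].
  have uv : u = v.
    by apply: nbelow1 b1 us vs _ _; rewrite et alphaM ?subsetUl ?subsetUr.
  by move: et b1; rewrite -uv tmulxx => -> ->; rewrite us.
split=> sH t.
  by case/allpairsP => -[u v] /= [us vs ->]; apply: rclosedM; auto.
by move=> ts; rewrite -[t]tmulxx; apply/sH/mem_prods.
Qed.

Lemma mirigCong_same_data x y :
  mirigCong x y -> same_data (trees x) (trees y).
Proof.
elim=> {x y} [x|x|x y _|x y z _ h _|x x' y y' _ h1 _ h2|x x' y y' _ h1 _ h2].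
- apply: same_data_trans (same_data_sqr _) _; apply: perm_same_data.
  by rewrite perm_sym trees_mul.
- exact: perm_same_data.
- exact: same_data_sym.
- exact: same_data_trans.
- apply: same_data_trans (perm_same_data (trees_add _ _)) _.
  apply: same_data_trans (same_data_cat h1 h2) _.
  by apply: perm_same_data; rewrite perm_sym trees_add.
- apply: same_data_trans (perm_same_data (trees_mul _ _)) _.
  apply: same_data_trans (same_data_prods h1 h2) _.
  by apply: perm_same_data; rewrite perm_sym trees_mul.
Qed.

End Data.

(** * Absorbed trees *)

Lemma seq_mset_cons (K : choiceType) (w : K) (ws : seq K) :
  seq_mset (w :: ws) = (w +` seq_mset ws)%mset.
Proof. by apply/msetP => w'; rewrite mset1DE !mset_seqE /= eq_sym. Qed.

Lemma seq_mset0 (K : choiceType) : seq_mset [::] = mset0 :> {mset K}%mset.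
Proof. by apply/msetP => w; rewrite mset_seqE mset0E. Qed.

Section Values.
Variable n : nat.
Local Notation R := (freeMirig n).
Implicit Types (t u v x y b c e : tree n) (s l : seq (tree n))
  (A B : {set 'I_n}).
Implicit Types (S X : {set tree n}) (r : R).
Local Open Scope ring_scope.

Definition monom (w : seq 'I_n) : freeRig n := [mset w]%mset.

Definition tree_class t : R := (\pi_R (monom (word t)))%qT.

Definition value s : R := \sum_(t <- s) tree_class t.

Lemma monomM (w w' : seq 'I_n) : monom w * monom w' = monom (w ++ w').
Proof.
rewrite [LHS]/(frmul _ _) /frmul /monom !enum_msetn /=.
by rewrite seq_mset_cons seq_mset0 msetD0.
Qed.

Lemma monom_tr w : (\pi_R (monom w))%qT = tree_class (tr w).
Proof.
apply: (band_ptrw (op := fun r r' : R => r * r')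
  (phi := fun w => (\pi_R (monom w))%qT)).
- exact: mulrA.
- exact: fm_mulrr.
- by move=> w1 w2; rewrite -monomM; apply: fm_piM.
by have := congr1 val (wordK (tr w)).
Qed.

Lemma tree_classM t u : tree_class (t * u)%g = tree_class t * tree_class u.
Proof. by rewrite -monom_tr -monomM; apply: fm_piM. Qed.

Lemma pi_trees (p : freeRig n) : (\pi_R p)%qT = value (trees p).
Proof.
rewrite /value big_map -{1}(seq_mset_id (p : {mset _}%mset)).
elim: (enum_mset (p : {mset _}%mset)) => [|w ws IHw].
  by rewrite big_nil seq_mset0.
by rewrite big_cons seq_mset_cons -monom_tr -IHw; apply: fm_piD.
Qed.

(** Squaring 2 = 1 + 1. *)
Lemma mulrn4 r : r *+ 4 = r *+ 2.
Proof.
by rewrite -mulr_natl -[4%N]/(2 * 2)%N natrM fm_mulrr mulr_natl.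
Qed.

Definition absorbs r t := r = r + tree_class t *+ 2.

(** Squaring u + v inside x _ y adds the two mixed terms, and adding them twice
makes room for one more copy of each double, as 4 = 2. *)
Lemma absorbs_pair r r0 x y u v :
  r = r0 + tree_class (x * u * y)%g + tree_class (x * v * y)%g ->
  absorbs r (x * (u * v) * y)%g.
Proof.
set a := tree_class (x * u * y)%g; set b := tree_class (x * v * y)%g.
set w := tree_class (x * (u * v) * y)%g;
  set w' := tree_class (x * (v * u) * y)%g.
have ab : a + b = a + b + (w + w').
  rewrite /a /b /w /w' !tree_classM -mulrDl -mulrDr
    -{1}[tree_class u + tree_class v]fm_mulrr.
  rewrite mulrDl !mulrDr !mulrDl !fm_mulrr.
  by rewrite !addrA [LHS](ACl (1*4*2*3)).
have ab2 : a + b = a + b + (w *+ 2 + w' *+ 2)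
  by rewrite -mulrnDl mulr2n (addrA (a + b)) -!ab.
have w4 : w *+ 2 + w *+ 2 = w *+ 2 by rewrite -mulrnDr mulrn4.
move=> er; rewrite /absorbs er -/w -(addrA r0).
(* The doubles are generalized because w *+ 2 unifies with w + w. *)
move: (w *+ 2) (w' *+ 2) ab2 w4 => c c' -> cc.
by rewrite !addrA [RHS](ACl (1*2*3*(4*6)*5)) /= cc.
Qed.

Lemma absorbs_rclosed r : rclosed (absorbs r).
Proof.
move=> x y u v; set a := tree_class (x * u * y)%g;
  set b := tree_class (x * v * y)%g.
rewrite /absorbs -/a -/b !mulr2n => ra rb.
apply: (@absorbs_pair _ (r + a + b)); rewrite -/a -/b.
by rewrite {1}rb {1}ra !addrA [RHS](ACl (1*2*4*3*5)).
Qed.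

Lemma value_perm s s' : perm_eq s s' -> value s = value s'.
Proof. exact: perm_big. Qed.

Lemma value_cons t s : value (t :: s) = tree_class t + value s.
Proof. exact: big_cons. Qed.

Lemma value_cat s s' : value (s ++ s') = value s + value s'.
Proof. exact: big_cat. Qed.

Section Full.
Variable s : seq (tree n).
Local Notation E := (alphas (solo s)).

Lemma alphas_soloP A : reflect (exists2 e, e \in solo s & alpha e = A)
  (A \in E).
Proof. by apply: (iffP imsetP) => -[e]; exists e. Qed.

Lemma solo_mem e : e \in solo s -> e \in s.
Proof. by rewrite mem_solo => /andP[]. Qed.

Lemma solo_uniq e t :
  e \in solo s -> t \in s -> alpha t \subset alpha e -> t = e.
Proof.
rewrite mem_solo => /andP[es /eqP b1] ts te.
exact: nbelow1 b1 ts es te (subxx _).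
Qed.

Lemma value_split t : t \in s -> value s = value (rem t s) + tree_class t.
Proof.
by move=> ts; rewrite (value_perm (perm_to_rem ts)) value_cons addrC.
Qed.

(** Some other entry u has its letters in t.  The pair t, u yields t u, and then
the pair t u, t yields t u t = t. *)
Lemma absorbs_full t : t \in s -> alpha t \notin E -> absorbs (value s) t.
Proof.
move=> ts tE.
have b1 : nbelow (alpha t) s != 1%N.
  by apply: contra tE => b1; apply/alphas_soloP; exists t;
    rewrite ?mem_solo ?ts.
have : (0 < nbelow (alpha t) (rem t s))%N.
  move: b1 (nbelow_gt0 ts); rewrite /nbelow (permP (perm_to_rem ts)) /= subxx.
  by case: (count _ _).
rewrite -has_count => /hasP[u us ut].
have tu : absorbs (value s) (t * u)%g.
  have := @absorbs_pair (value s) (value (rem u (rem t s))) 1%g 1%g t u.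
  rewrite !mul1g !mulg1; apply.
  rewrite (value_split ts) (value_perm (perm_to_rem us)) value_cons.
  by rewrite [LHS](ACl (2*3*1)).
rewrite -(tree_sandwich ut).
have := @absorbs_pair (value s) (value (rem t s) + tree_class (t * u)%g) 1%g 1%g
  (t * u)%g t.
rewrite !mul1g !mulg1; apply.
by rewrite {1}tu {1}(value_split ts) mulr2n addrA [LHS](ACl (1*3*4*2)).
Qed.

(** What holds of every tree of the generated replete subsemigroup.  The first
clause says that solo trees have minimal alphabets; the second is the only trace
of a solo tree, which is itself not absorbed. *)
Definition governed t := [/\ exists2 u, u \in s & alpha u \subset alpha t,
  forall e, e \in solo s -> alpha e = alpha t -> lmp t = lmp e /\ rmp t = rmp e
  & alpha t \notin E -> absorbs (value s) t].

Lemma absorbs_saturated e t b c :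
  lmp b = lmp e -> rmp b = rmp e -> lmp c = lmp t -> rmp c = rmp t ->
  absorbs (value s) (e * t)%g -> absorbs (value s) (b * c)%g.
Proof.
move=> lb rb lc rc et.
have clE := @absorbs_rclosed (value s).
have bt : absorbs (value s) (b * t)%g.
  have := rclosed_saturated (rclosed_residual (x := 1%g) (y := t) clE) lb rb.
  by rewrite !mul1g; apply.
have := rclosed_saturated (rclosed_residual (x := b) (y := 1%g) clE) lc rc.
by rewrite !mulg1; apply.
Qed.

(** If b has the alphabet of a solo tree e then b need not be absorbed.  But e
is an entry, and c, or the solo tree with the alphabet of c, is available next
to it; so the product with e is absorbed, and a residual leads from e to b,
which has the same paths. *)
Lemma governed_mul b c : governed b -> governed c ->
  alpha b :|: alpha c \notin E -> absorbs (value s) (b * c)%g.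
Proof.
move=> [_ Kb2 Kb3] [_ Kc2 Kc3] bcE.
have pair r0 e t : value s = r0 + tree_class e + tree_class t ->
  absorbs (value s) (e * t)%g.
  move=> er; have := @absorbs_pair (value s) r0 1%g 1%g e t.
  by rewrite !mul1g !mulg1; apply.
have [/alphas_soloP[e eI eb]|/Kb3 bG] := boolP (alpha b \in E);
  have [/alphas_soloP[f fI fc]|/Kc3 cG] := boolP (alpha c \in E).
- have [lb rb] := Kb2 _ eI eb; have [lc rc] := Kc2 _ fI fc.
  apply: (absorbs_saturated lb rb lc rc).
  have ef : e != f.
    apply: contra bcE => /eqP ef; rewrite -eb -fc ef setUid.
    by apply/alphas_soloP; exists f.
  have fs : f \in rem e s.
    have := solo_mem fI; rewrite (perm_mem (perm_to_rem (solo_mem eI))) inE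
      eq_sym.
    by rewrite (negPf ef).
  apply: (pair (value (rem f (rem e s)))).
  rewrite (value_split (solo_mem eI)) (value_perm (perm_to_rem fs)) value_cons.
  by rewrite [LHS](ACl (2*3*1)).
- have [lb rb] := Kb2 _ eI eb.
  apply: (absorbs_saturated lb rb (erefl (lmp c)) (erefl (rmp c))).
  (* The summand c comes from its absorption. *)
  apply: (pair (value (rem e s) + tree_class c)).
  by rewrite {1}cG (value_split (solo_mem eI)) mulr2n addrA
    [LHS](ACl (1*3*2*4)).
- have [lc rc] := Kc2 _ fI fc.
  apply: (absorbs_saturated (erefl (lmp b)) (erefl (rmp b)) lc rc).
  (* The summand b comes from its absorption. *)
  apply: (pair (value (rem f s) + tree_class b)).
  by rewrite {1}bG (value_split (solo_mem fI)) mulr2n addrA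
    [LHS](ACl (1*3*4*2)).
- by apply: rclosedM; first exact: absorbs_rclosed.
Qed.

(** Let b = x u y, c = x v y and w = x u v y.  When the alphabet of w is not
that of a solo tree, b c and c b are absorbed, hence so is b c b.  Inserting u
and v in b c b = x [u] y c b and c b = x [v] y c b gives w c b; symmetrically b
c w is absorbed; and the product of w c b and b c w is w. *)
Lemma governed_rclosed : rclosed governed.
Proof.
move=> x y u v; set b := (x * u * y)%g; set c := (x * v * y)%g => Kb Kc.
set w := (x * (u * v) * y)%g.
have aw : alpha w = alpha b :|: alpha c.
  rewrite /w /b /c !alphaM; apply/setP => i; rewrite !inE.
  by case: (i \in alpha x) (i \in alpha y) (i \in alpha u) (i \in alpha v)
    => [] [] [] [].
have min d e : governed d -> e \in solo s -> alpha d \subset alpha e ->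
  alpha e = alpha d.
  case=> [[z zs zd] _ _] eI de; apply/eqP; rewrite eqEsubset de andbT.
  by rewrite -(solo_uniq eI zs (subset_trans zd de)).
split.
- have [[z zs zb] _ _] := Kb; exists z => //.
  by rewrite aw; apply: subset_trans zb (subsetUl _ _).
- move=> e eI ew.
  have eb : alpha e = alpha b by apply: (min _ _ Kb eI); rewrite ew aw subsetUl.
  have ec : alpha e = alpha c by apply: (min _ _ Kc eI); rewrite ew aw subsetUr.
  have [_ /(_ e eI eb)[lb rb] _] := Kb; have [_ /(_ e eI ec)[lc rc] _] := Kc.
  by split; [apply: rclosed_lmp | apply: rclosed_rmp].
rewrite aw => wE; have bc := governed_mul Kb Kc wE.
have cb : absorbs (value s) (c * b)%g.
  by apply: governed_mul => //; rewrite setUC.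
have clG := @absorbs_rclosed (value s).
have bcb : absorbs (value s) (b * c * b)%g.
  have := rclosedM clG bc cb.
  by rewrite -mulgA (mulgA c c b) tmulxx mulgA.
have wcb : absorbs (value s) (w * (c * b))%g.
  have := clG x (y * (c * b))%g u v.
  have e2 z : (x * z * (y * (c * b)) = x * z * y * (c * b))%g by rewrite !mulgA.
  rewrite !e2 -/b -/c => H; apply: H; first by rewrite mulgA.
  by rewrite mulgA tmulxx.
have bcw : absorbs (value s) (b * c * w)%g.
  have := clG (b * c * x)%g y u v; rewrite /w.
  have e2 z : (b * c * x * z * y = b * c * (x * z * y))%g by rewrite !mulgA.
  rewrite !e2 -/b -/c => H; apply: H => //.
  by rewrite -mulgA tmulxx.
have := rclosedM clG wcb bcw.
have -> : (w * (c * b) * (b * c * w) = w * (c * b * (b * c)) * w)%g.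
  by rewrite !mulgA.
rewrite tree_sandwich //.
by rewrite aw (alphaM _ (b * c)%g) (alphaM c) (alphaM b) !subUset !subsetUl
  !subsetUr.
Qed.

Lemma rclosure_governed t : t \in rclosure [set u in s] -> governed t.
Proof.
apply: (rclosure_min governed_rclosed) => {}t; rewrite inE => ts; split.
- by exists t.
- by move=> e eI et; rewrite (solo_uniq eI ts) ?et.
- exact: absorbs_full.
Qed.

End Full.

End Values.

(** * Normal form *)

Section NormalForm.
Variable n : nat.
Local Notation R := (freeMirig n).
Implicit Types (t u v e : tree n) (s l : seq (tree n)) (A B : {set 'I_n}).
Implicit Types (S X I F : {set tree n}) (r z : R).
Local Open Scope ring_scope.

Definition parity s : {set {set 'I_n}} :=
  [set A | odd (count (fun t => alpha t == A) s)].

Definition rep F A : tree n := odflt 1%g [pick t in F | alpha t == A].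

Lemma repP F t : t \in F ->
  rep F (alpha t) \in F /\ alpha (rep F (alpha t)) = alpha t.
Proof.
move=> tF; rewrite /rep; case: pickP => [u /andP[uF /eqP]|/(_ t)] //.
by rewrite tF eqxx.
Qed.

(** Here z stands for a sum that already contains all doubles of trees of F, so
that modulo z sums of such trees have exponent 2. *)
Section Parity.
Variables (z : R) (F : {set tree n}).
Hypothesis zF : {in F, forall t, z + tree_class t *+ 2 = z}.
Hypothesis FM : {in F &, forall t u, alpha t = alpha u -> (t * u)%g \in F}.

(** The classical proof that Boolean rings are commutative, modulo z. *)
Lemma add_swap u v : u \in F -> v \in F -> alpha u = alpha v ->
  z + tree_class (u * v)%g = z + tree_class (v * u)%g.
Proof.
move=> uF vF uv; have uvF := FM uF vF uv; have vuF := FM vF uF (esym uv).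
have zu := zF uF; have zv := zF vF; have zvu := zF vuF.
have zz : z = z + tree_class (u * v)%g + tree_class (v * u)%g.
  have sq : tree_class u + tree_class v =
    tree_class u + tree_class v + tree_class (u * v)%g + tree_class (v * u)%g.
    rewrite !tree_classM -{1}[tree_class u + tree_class v]fm_mulrr mulrDl
      !mulrDr !fm_mulrr.
    by rewrite !addrA [LHS](ACl (1*4*2*3)).
  have <- : z + tree_class u *+ 2 + tree_class v *+ 2 = z by rewrite zu zv.
  rewrite !mulr2n.
  have -> : z + (tree_class u + tree_class u) + (tree_class v + tree_class v)
      = z + tree_class u + tree_class v + (tree_class u + tree_class v)
        by rewrite !addrA [LHS](ACl (1*2*4*3*5)).
  by rewrite {1}sq !addrA.
by rewrite [in RHS]zz -(addrA (z + _)) -mulr2n addrAC zvu.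
Qed.

(** Both t = t (u t) and u = (u t) u become u t once their two factors are
swapped. *)
Lemma add_same_alpha t u : t \in F -> u \in F -> alpha t = alpha u ->
  z + tree_class t = z + tree_class u.
Proof.
move=> tF uF tu; have utF := FM uF tF (esym tu).
have a_ut : alpha (u * t)%g = alpha t by rewrite alphaM tu setUid.
have tut : (t * (u * t))%g = t by rewrite mulgA tree_sandwich ?tu.
have utu : (u * t * u)%g = u by rewrite tree_sandwich ?tu.
have := add_swap tF utF (esym a_ut); rewrite tut -mulgA tmulxx => ->.
have := add_swap uF utF; rewrite a_ut => /(_ (esym tu)).
by rewrite utu mulgA tmulxx.
Qed.

Lemma value_parity l : {subset l <= F} ->
  z + value l = z + \sum_(A in parity l) tree_class (rep F A).
Proof.
elim: l => [|t l IHl] lF.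
  rewrite /value big_nil big1 ?addr0 // => A; by rewrite inE.
have tF : t \in F by apply: lF; rewrite mem_head.
have [rF ra] := repP tF.
have in_par A : (A \in parity (t :: l)) = (alpha t == A) (+) (A \in parity l).
  by rewrite !inE /= oddD; case: eqP.
rewrite value_cons addrCA [tree_class t + _]addrC IHl; last first.
  by move=> u ul; apply: lF; rewrite inE ul orbT.
rewrite addrAC (add_same_alpha tF rF (esym ra)).
have [tp|tp] := boolP (alpha t \in parity l).
  rewrite (big_setD1 _ tp) /= addrA -(addrA z) -mulr2n zF //.
  congr (_ + _); apply: eq_bigl => A; rewrite in_par in_setD1 eq_sym.
  by case: eqP => [<-|_] //=; rewrite tp.
rewrite -addrA; congr (_ + _).
rewrite [RHS](bigD1 (alpha t)) /=; last by rewrite in_par eqxx (negPf tp).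
congr (_ + _); apply: eq_bigl => A; rewrite in_par eq_sym.
by case: eqP => [->|] /=; rewrite ?andbF ?andbT ?(negPf tp).
Qed.

End Parity.

Definition free_part S I : {set tree n} :=
  [set t in S | alpha t \notin alphas I].

Definition doubled F : R := \sum_(t in F) tree_class t *+ 2.

Lemma doubledF F : {in F, forall t, doubled F + tree_class t *+ 2 = doubled F}.
Proof.
move=> t tF; rewrite /doubled (bigD1 t) //= addrAC; congr (_ + _).
by rewrite -mulrnDr mulrn4.
Qed.

Lemma value_doubled s :
  value s = value s + doubled (free_part (rclosure [set t in s]) (solo s)).
Proof.
set F := free_part _ _; rewrite /doubled.
have: {in F, forall t, absorbs (value s) t}.
  by move=> t; rewrite inE => /andP[/rclosure_governed[_ _ h] /h].
rewrite -big_enum /= => Fs.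
have : {in enum F, forall t, absorbs (value s) t}.
  by move=> t; rewrite mem_enum; apply: Fs.
elim: (enum F) => [|t l IHl] tl; first by rewrite big_nil addr0.
rewrite big_cons addrA -(tl t (mem_head _ _)); apply: IHl.
by move=> u ul; apply: tl; rewrite inE ul orbT.
Qed.

Lemma perm_solo_filter s :
  perm_eq [seq t <- s | alpha t \in alphas (solo s)] (enum (solo s)).
Proof.
have memE t : (t \in [seq t <- s | alpha t \in alphas (solo s)]) =
  (t \in solo s).
  rewrite mem_filter; apply/andP/idP => [[/alphas_soloP[e eI et] ts]|tI].
    by rewrite (solo_uniq eI ts) ?et.
  by split; [apply/alphas_soloP; exists t | apply: solo_mem].
apply: uniq_perm; last by move=> t; rewrite memE mem_enum.
  apply: count_mem_uniq => t; rewrite memE;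
    have [tI|tI] := boolP (t \in solo s).
    apply/eqP; rewrite eqn_leq -has_count has_pred1 memE tI andbT.
    move: (tI); rewrite mem_solo => /andP[_ /eqP b1].
    rewrite -[nat_of_bool true]/1%N -b1 count_filter;
      apply: sub_count => u /= /andP[/eqP -> _]; exact: subxx.
  by apply/count_memPn; rewrite memE.
exact: enum_uniq.
Qed.

Lemma parity_filter s (P : pred {set 'I_n}) :
  parity [seq t <- s | P (alpha t)] = [set A in parity s | P A].
Proof.
apply/setP => A; rewrite !inE count_filter.
have [PA|PA] := boolP (P A); rewrite ?andbT ?andbF.
  by congr odd; apply: eq_count => t /=; case: eqP => [->|//]; rewrite PA.
rewrite (@eq_count _ _ pred0) ?count_pred0 // => t /=.
by case: eqP => [->|//]; rewrite (negPf PA).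
Qed.

Definition data s := (rclosure [set t in s], solo s, parity s).

(** The right-hand side mentions s only through its three invariants. *)
Lemma value_normal s (F := free_part (rclosure [set t in s]) (solo s)) :
  value s = \sum_(t in solo s) tree_class t
    + (doubled F + \sum_(A in [set A in parity s | A \notin alphas (solo s)])
         tree_class (rep F A)).
Proof.
rewrite {1}value_doubled -/F.
rewrite (value_perm (s' := enum (solo s) ++
   [seq t <- s | alpha t \notin alphas (solo s)])); last first.
  rewrite -(perm_filterC (fun t => alpha t \in alphas (solo s)) s).
  by rewrite perm_cat2r perm_solo_filter.
rewrite value_cat -addrA {1}/value big_enum; congr (_ + _).
rewrite addrC (value_parity (F := F)).
- by rewrite (parity_filter s (fun A => A \notin alphas (solo s))).
- exact: doubledF.
- move=> t u; rewrite !inE => /andP[tS tI] /andP[uS _] tu.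
  by rewrite alphaM -tu setUid tI (rclosedM (@rclosed_rclosure _ _)).
move=> t; rewrite mem_filter !inE => /andP[-> ts]; rewrite andbT.
by apply: (subsetP (sub_rclosure _)); rewrite inE.
Qed.

Lemma value_data s s' : data s = data s' -> value s = value s'.
Proof. by case=> eS eI eP; rewrite !value_normal eS eI eP. Qed.

End NormalForm.

(** * Realization of the invariants *)

Section Image.
Variable n : nat.
Implicit Types (t u v e : tree n) (s l : seq (tree n)) (A B : {set 'I_n}).
Implicit Types (S X I F : {set tree n}) (P : {set {set 'I_n}}).

Lemma nbelow_sum A s :
  nbelow A s =
  \sum_(B : {set 'I_n} | B \subset A) count (fun t => alpha t == B) s.
Proof.
rewrite /nbelow; elim: s => [|t s IHs] /=; first by rewrite big1.
rewrite IHs big_split /=; congr (_ + _).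
have [tA|tA] := boolP (alpha t \subset A).
  by rewrite (bigD1 (alpha t)) //= eqxx big1 // => B /andP[_];
    rewrite eq_sym => /negPf->.
by rewrite big1 // => B BA; case: eqP => // e; rewrite e BA in tA.
Qed.

(** Moebius inversion modulo 2: the counts over all subsets of an alphabet
determine, by induction, the count over the alphabet itself. *)
Lemma nbelow_parity s s' :
  (forall A, odd (nbelow A s) = odd (nbelow A s')) -> parity s = parity s'.
Proof.
move=> ss'; apply/setP => A; rewrite !inE.
have [d] := ubnP #|A|; elim: d A => // d IHd A ltd.
have := ss' A; rewrite !nbelow_sum !(bigD1 A (P := fun B => B \subset A)) //=
  !oddD.
rewrite (_ : odd (\sum_(B : {set 'I_n} | (B \subset A) && (B != A)) count
  (fun t => alpha t == B) s)
  = odd (\sum_(B : {set 'I_n} | (B \subset A) && (B != A)) count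
    (fun t => alpha t == B) s')).
  by move/addIb.
elim/big_ind2: _ => [//|k k' l l' e e'|B].
  by rewrite !oddD e e'.
rewrite andbC -properEneq => /proper_card BA.
by apply: IHd; apply: leq_trans BA _; rewrite -ltnS.
Qed.

Lemma same_data_eq s s' : same_data s s' -> data s = data s'.
Proof.
case=> b t h; rewrite /data t (@nbelow_parity s s'); last first.
  by move=> A; have /and3P[/eqP] := b A.
rewrite (@rclosure_eq n [set t in s] [set t in s']) // => H /h hH.
have inset (l : seq (tree n)) : {in [set t in l], forall t, H t} <->
  {in l, forall t, H t}.
  by split=> lH u ul; apply: lH; move: ul; rewrite inE.
by rewrite !inset.
Qed.

(** The equality of cardinals says that the trees of I have pairwise distinct
alphabets. *)
Definition admissible S I P : bool :=
  [&& subsemigroup S && replete S, I \subset S, #|alphas I| == #|I|,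
      alphas I \subset alphas_m S &
        (alphas I \subset P) && (P \subset alphas S)].

Lemma card_imfset1P (K : choiceType) (g : tree n -> K) (X : {set tree n}) e :
  e \in X -> reflect {in X, forall t, g t = g e}
    (#|` [fset g t | t in X]| == 1)%fset.
Proof.
move=> eX; apply: (iffP idP) => [/cardfs1P[x ex] t tX|ge].
  have inx u : u \in X -> g u = x.
    by move=> uX; apply/fset1P; rewrite -ex; apply/imfsetP; exists u.
  by rewrite !inx.
apply/cardfs1P; exists (g e); apply/fsetP => y; rewrite inE.
apply/imfsetP/eqP => [[t /= tX ->]|->]; first exact: ge.
by exists e.
Qed.

Lemma in_withAlpha S A t : (t \in withAlpha S A) = (t \in S) && (alpha t == A).
Proof. by rewrite inE. Qed.

Lemma alphas_mP S e : e \in S -> reflect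
  [/\ forall t, t \in S -> alpha t \subset alpha e -> alpha t = alpha e,
      forall t, t \in S -> alpha t = alpha e -> lmp t = lmp e
    & forall t, t \in S -> alpha t = alpha e -> rmp t = rmp e]
  (alpha e \in alphas_m S).
Proof.
move=> eS; have eA : e \in withAlpha S (alpha e)
  by rewrite in_withAlpha eS eqxx.
rewrite inE imset_f //=; apply: (iffP and3P)
  => [[/minsetP[_ m] /(card_imfset1P (@lmp n) eA) l /(card_imfset1P (@rmp n) eA)
    r]|[m l r]].
  split=> t tS et; last 2 first.
  - by apply: l; rewrite in_withAlpha tS et eqxx.
  - by apply: r; rewrite in_withAlpha tS et eqxx.
  by apply: m => //; apply: imset_f.
split.
- apply/minsetP; split; first exact: imset_f.
  by move=> B /imsetP[t tS ->]; apply: m.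
- by apply/(card_imfset1P (@lmp n) eA) => t;
  rewrite in_withAlpha => /andP[tS /eqP]; apply: l.
- by apply/(card_imfset1P (@rmp n) eA) => t;
  rewrite in_withAlpha => /andP[tS /eqP]; apply: r.
Qed.

Lemma data_admissible s :
  admissible (rclosure [set t in s]) (solo s) (parity s).
Proof.
have sS t : t \in s -> t \in rclosure [set t in s].
  by move=> ts; apply: (subsetP (sub_rclosure _)); rewrite inE.
apply/and5P; split.
- by apply/rclosedP/rclosed_rclosure.
- by apply/subsetP => t /solo_mem/sS.
- apply/eqP/card_in_imset => t u tI uI tu.
  by apply: (solo_uniq uI); rewrite ?solo_mem ?tu.
- apply/subsetP => A /imsetP[e eI ->].
  apply/alphas_mP; first exact/sS/solo_mem.
  split=> t /rclosure_governed[[u us ut] K2 _] te; last 2 first.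
  - by have [] := K2 _ eI (esym te).
  - by have [] := K2 _ eI (esym te).
  apply/eqP; rewrite eqEsubset te /=.
  by rewrite -(solo_uniq eI us (subset_trans ut te)).
apply/andP; split; apply/subsetP => A.
  case/imsetP=> e eI ->; rewrite inE (_ : count _ s = 1) //.
  apply/eqP; rewrite eqn_leq -has_count; apply/andP; split; last first.
    by apply/hasP; exists e; rewrite ?solo_mem.
  move: (eI); rewrite mem_solo => /andP[_ /eqP <-].
  by apply: sub_count => t /= /eqP->; apply: subxx.
rewrite inE => odd_s; have : has (fun t => alpha t == A) s.
  by rewrite has_count; case: count odd_s.
by case/hasP => t /sS tS /eqP <-; apply: imset_f.
Qed.

(** The list consists of I, of two copies of every tree of S whose alphabet is
not that of a tree of I, and of one more tree for each alphabet whose parity has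
to be corrected. *)
Lemma admissible_data S I P : admissible S I P -> exists s, data s = (S, I, P).
Proof.
case/and5P=> /rclosedP clS /subsetP IS /imset_injP injI /subsetP Im.
case/andP=> /subsetP IP /subsetP PS; set F := free_part S I.
pose Q := P :\: alphas I.
have FP t : (t \in F) = (t \in S) && (alpha t \notin alphas I) by rewrite inE.
have repF A : A \in Q -> rep F A \in F /\ alpha (rep F A) = A.
  rewrite inE => /andP[AI /PS/imsetP[t tS eA]].
  by rewrite eA; apply: repP; rewrite FP tS -eA.
have FI t e : t \in F -> e \in I -> alpha t != alpha e.
  move=> tF eI; move: tF; rewrite FP => /andP[_]; apply: contra => /eqP->.
  exact: imset_f.
pose s1 := enum I; pose s2 := enum F; pose s3 := [seq rep F A | A <- enum Q].
have s3F t : t \in s3 -> t \in F.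
  by case/mapP => A; rewrite mem_enum => /repF[? _] ->.
pose s := s1 ++ (s2 ++ s2) ++ s3; exists s.
have sE t : (t \in s) = (t \in I) || (t \in F).
  rewrite !mem_cat !mem_enum orbb; have := s3F t.
  by case: (t \in s3) => [->|] //; rewrite ?orbF ?orbT.
have sS t : t \in s -> t \in S.
  by rewrite sE => /orP[/IS|] //; rewrite FP => /andP[].
have eclo : rclosure [set t in s] = S.
  apply/eqP; rewrite eqEsubset; apply/andP; split; apply/subsetP.
    by apply: (rclosure_min clS) => t; rewrite inE => /sS.
  move=> t tS; have sc u : u \in s -> u \in rclosure [set t in s].
    by move=> us; apply: (subsetP (sub_rclosure _)); rewrite inE.
  have [/imsetP[e eI te]|tI] := boolP (alpha t \in alphas I); last first.
    by apply: sc; rewrite sE FP tS tI orbT.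
  have /(alphas_mP (IS _ eI))[_ l r] := Im _ (imset_f _ eI).
  apply: (rclosed_saturated (@rclosed_rclosure _ _) (l _ tS te) (r _ tS te)).
  by apply: sc; rewrite sE eI.
(* The trees of F avoid the alphabet of e, which is therefore seen only once. *)
have count1 e (p : pred (tree n)) : e \in I -> p e ->
  {in s, forall t, p t -> alpha t = alpha e} ->
    count p s = 1.
  move=> eI pe ps.
  have none l : {subset l <= F} -> count p l = 0.
    move=> lF; rewrite (@eq_in_count _ _ pred0) ?count_pred0 // => t /lF tF /=.
    apply/negP => /ps pt; have := FI t e tF eI; rewrite pt ?eqxx //.
    by rewrite sE tF orbT.
  rewrite !count_cat !(none s2) ?(none s3) //; last by move=> t;
    rewrite mem_enum.
  rewrite !addn0 (@eq_in_count _ _ (pred1 e)).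
    by rewrite count_uniq_mem ?enum_uniq // mem_enum eI.
  move=> t; rewrite mem_enum => tI /=; apply/idP/eqP => [pt|-> //].
  by apply: injI => //; apply: ps => //; rewrite sE tI.
have etops : solo s = I.
  apply/setP => t; rewrite mem_solo; apply/andP/idP => [[]|tI].
    rewrite sE => /orP[//|tF] /eqP.
    have : 0 < count (fun u => alpha u \subset alpha t) s2.
      by rewrite -has_count; apply/hasP; exists t; rewrite ?mem_enum ?subxx.
    rewrite /nbelow !count_cat.
    by case: (count _ s2) => // k _; rewrite !(addnS, addSn).
  split; first by rewrite sE tI.
  apply/eqP/(count1 t) => //= u us ut.
  by have /(alphas_mP (IS _ tI))[m _ _] := Im _ (imset_f _ tI); apply: m; auto.
rewrite /data eclo etops; congr (_, _, _); apply/setP => A; rewrite inE.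
have [/imsetP[e eI eA]|AI] := boolP (A \in alphas I).
  rewrite (count1 e) ?eA //; first by apply/esym/IP/imset_f.
  by move=> t _ /eqP.
rewrite !count_cat addnn addnA oddD oddD odd_double addbF.
rewrite (@eq_in_count _ _ pred0) ?count_pred0 /=; last first.
  move=> t; rewrite mem_enum => tI /=; apply: contraNF AI => /eqP <-.
  exact: imset_f.
rewrite count_map (@eq_in_count _ _ (pred1 A)).
  by rewrite count_uniq_mem ?enum_uniq // mem_enum oddb inE AI.
by move=> B; rewrite mem_enum => /repF[_ /= ->].
Qed.

End Image.

(** * Counting trees with prescribed paths *)

Section CountTrees.
Variable n : nat.
Implicit Types (t u e : tree n) (A B : {set 'I_n}) (a b : 'I_n).
Implicit Types (r : seq 'I_n) (p q : pred (seq 'I_n)).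

(** The possible left, or right, halves of a tree with alphabet A. *)
Definition halves A : {set 'I_n * tree n} :=
  [set x | (x.1 \in A) && (alpha x.2 == A :\ x.1)].

Definition glue (z : ('I_n * tree n) * ('I_n * tree n)) : tree n :=
  (z.1.2 * gen z.1.1 * gen z.2.1 * z.2.2)%g.

Lemma tval_glue A z : z \in setX (halves A) (halves A) ->
  tval (glue z) = Node (tval z.1.2) z.1.1 z.2.1 (tval z.2.2)
  /\ alpha (glue z) = A.
Proof.
case: z => -[a t0] [b t1]; rewrite in_setX => /andP[].
rewrite !in_set => /andP[aA /eqP e0] /andP[bA /eqP e1].
have i : istree (Node (tval t0) a b (tval t1)).
  rewrite /= (valP t0 : istree (tval t0)) (valP t1 : istree (tval t1)).
  rewrite (e0 : palpha (tval t0) = _) (e1 : palpha (tval t1) = _) !setD1K //.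
  by rewrite !inE !eqxx.
have -> : glue ((a, t0), (b, t1)) = Tree i.
  rewrite -[RHS]wordK /glue /= -[in LHS](wordK t0) -[in LHS](wordK t1).
  by rewrite /gen -!trM -!catA.
by split=> //; rewrite /alpha /= (e0 : palpha (tval t0) = _) setD1K.
Qed.

Lemma glue_inj A : {in setX (halves A) (halves A) &, injective glue}.
Proof.
move=> z z' /tval_glue[e _] /tval_glue[e' _] ee.
move: e; rewrite ee e'; case: z {e' ee} => -[a t0] [b t1] /=.
by case: z' => -[a' t0'] [b' t1'] /= [] /val_inj-> -> -> /val_inj->.
Qed.

Lemma alpha_glue A t : A != set0 -> alpha t = A ->
  exists2 z, z \in setX (halves A) (halves A) & t = glue z.
Proof.
move=> A0 tA; case: (treeP t) => [t1|t0 a b t1 et a0 b1 eA eB _ _].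
  by rewrite -tA t1 alpha1 eqxx in A0.
exists ((a, t0), (b, t1)) => //; rewrite !inE /= -tA -{1}eA -{2}eB !setU11 /=.
by rewrite -{1}eA -eB !setU1K ?eqxx.
Qed.

Definition treesOf A p q : {set tree n} :=
  [set t | [&& alpha t == A, p (lmp t) & q (rmp t)]].

(** The two halves of a tree can be chosen independently; the first determines
the leftmost path and the second the rightmost path. *)
Lemma card_treesOf A p q : A != set0 -> #|treesOf A p q| =
  #|[set x in halves A | p (rcons (lmp x.2) x.1)]|
  * #|[set y in halves A | q (y.1 :: rmp y.2)]|.
Proof.
move=> A0; rewrite -cardsX.
set X := setX _ _; have subX : {subset X <= setX (halves A) (halves A)}.
  by case=> x y; rewrite !inE /= => /andP[/andP[-> _] /andP[-> _]].
have Xin z : z \in X = [&& z \in setX (halves A) (halves A), p (lmp (glue z)) &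
  q (rmp (glue z))].
  have [zH|zH] := boolP (z \in setX (halves A) (halves A)); last first.
    by apply: contraNF zH => /subX.
  rewrite /lmp /rmp (tval_glue zH).1 /=.
  by case: z zH => x y; rewrite !inE /= => /andP[-> ->].
rewrite -(card_in_imset (f := glue) (D := X)); last first.
  by move=> z z' /subX zX /subX zX'; apply: (glue_inj zX zX').
apply: eq_card => t; rewrite inE; apply/and3P/imsetP.
  case=> /eqP tA pt qt; have [z zH et] := alpha_glue A0 tA.
  by exists z => //; rewrite Xin zH -et pt qt.
by case=> z; rewrite Xin => /and3P[zH pz qz] ->; rewrite (tval_glue zH).2 pz qz.
Qed.

(** The number of trees on k letters. *)
Definition ntree k := \prod_(1 <= j < k.+1) j ^ (2 ^ (k - j + 1)).

(** The number of trees on k letters with a given leftmost path, or with a given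
rightmost path. *)
Definition nlmp k := \prod_(1 <= j < k.+1) j ^ (2 ^ (k - j + 1) - 1).

Lemma ntreeS k : ntree k.+1 = (k.+1 * ntree k) * (k.+1 * ntree k).
Proof.
rewrite /ntree big_nat_recr //= subnn mulnACA [RHS]mulnC; congr (_ * _).
rewrite -big_split /= big_nat [RHS]big_nat; apply: eq_bigr => j /andP[_ jk].
by rewrite subSn // addSn expnS mul2n -addnn expnD.
Qed.

Lemma nlmpS k : nlmp k.+1 = nlmp k * (k.+1 * ntree k).
Proof.
rewrite /nlmp /ntree big_nat_recr //= subnn mulnCA [RHS]mulnC; congr (_ * _).
rewrite -big_split /= big_nat [RHS]big_nat; apply: eq_bigr => j /andP[_ jk].
by rewrite subSn // addSn expnS mul2n -addnn -expnD (addnBAC (n := 1))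
  ?expn_gt0.
Qed.

Lemma nlmp_sqr k : nlmp k * nlmp k =
  \prod_(1 <= j < k.+1) j ^ (2 ^ (k.+1 - j + 1) - 2).
Proof.
rewrite /nlmp -big_split /= big_nat [RHS]big_nat;
  apply: eq_bigr => j /andP[_ jk].
by rewrite subSn // addSn expnS -expnD addnn -mul2n mulnBr.
Qed.

Lemma card_alpha_halves A :
  #|treesOf A xpredT xpredT| = ntree #|A| /\ #|halves A| = #|A| * ntree #|A|.-1.
Proof.
have [d] := ubnP #|A|; elim: d A => // d IHd A ltd.
have hA : #|halves A| = #|A| * ntree #|A|.-1.
  rewrite -sum1_card (partition_big (fun x => x.1) (mem A)) => [|x]; last first.
    by rewrite inE => /andP[].
  rewrite -sum_nat_const; apply: eq_bigr => a ainA; have aA : a \in A by [].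
  have cA : #|A :\ a| = #|A|.-1 by rewrite (cardsD1 a A) aA.
  have [<- _] : #|treesOf (A :\ a) xpredT xpredT| = ntree #|A|.-1 /\ True.
    by rewrite -cA; split=> //; apply: (proj1 (IHd _ _));
      rewrite -ltnS (leq_trans _ ltd) // [#|A|](cardsD1 a) aA.
  rewrite sum1_card -[RHS](card_imset _
    (can_inj (f := pair a) (g := snd) (fun=> erefl))).
  apply: eq_card => -[b t]; rewrite [LHS]unfold_in !inE /=.
  apply/andP/imsetP => [[/andP[bA tA] /eqP ba]|[u]].
    by exists t; rewrite ?inE -ba // tA.
  by rewrite !inE => /and3P[ua _ _] [-> ->]; rewrite aA ua eqxx.
split=> //; have [A0|A0] := eqVneq A set0.
  rewrite A0 cards0 /ntree big_geq //; apply/eqP/cards1P; exists (1%g : tree n).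
  by apply/setP => t; rewrite !inE !andbT alpha_eq0.
rewrite card_treesOf //.
have eqh (P : pred ('I_n * tree n)) : (forall x, P x) ->
  #|[set x in halves A | P x]| = #|halves A|.
  by move=> PT; apply: eq_card => x; rewrite inE PT andbT.
rewrite !eqh // hA; case E: #|A| A0 => [|k] A0; last by rewrite -ntreeS.
by move/eqP: E; rewrite cards_eq0 (negPf A0).
Qed.

Lemma card_lmp A e : alpha e = A ->
  #|treesOf A (pred1 (lmp e)) xpredT| = nlmp #|A|.
Proof.
have [d] := ubnP #|A|; elim: d A e => // d IHd A e ltd eA.
have [A0|A0] := eqVneq A set0.
  rewrite A0 cards0 /nlmp big_geq //; apply/eqP/cards1P; exists e.
  apply/setP => t; rewrite !inE andbT.
  move: (eA); rewrite A0 => /eqP; rewrite !alpha_eq0 => /eqP->.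
  by case: eqP => [->|//]; rewrite eqxx.
case: (treeP e) => [e1|e0 a b e1 _ a0 _ eA0 _ el _].
  by rewrite -eA e1 alpha1 eqxx in A0.
have aA : a \in A by rewrite -eA -eA0 setU11.
have cA : #|A| = #|A :\ a|.+1 by rewrite (cardsD1 a A) aA.
have e0A : alpha e0 = A :\ a by rewrite -eA -eA0 setU1K.
rewrite card_treesOf // [X in _ * X](_ : _ = #|halves A|); last first.
  by apply: eq_card => y; rewrite inE andbT.
rewrite (card_alpha_halves A).2 cA /= nlmpS; congr (_ * _).
rewrite -(IHd (A :\ a) e0) //; last by rewrite -ltnS -cA.
rewrite -[RHS](card_imset _ (can_inj (f := pair a) (g := snd) (fun=> erefl))).
apply: eq_card => -[c t]; rewrite !inE /= el; apply/andP/imsetP.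
  case=> /andP[cA' tA] /eqP /rcons_inj[lt ca]; exists t; last by rewrite ca.
  by rewrite inE /= -ca tA lt eqxx.
by case=> u; rewrite !inE => /and3P[uA /eqP ul _] [-> ->];
  rewrite aA uA ul eqxx.
Qed.

Lemma card_rmp A e : alpha e = A ->
  #|treesOf A xpredT (pred1 (rmp e))| = nlmp #|A|.
Proof.
have [d] := ubnP #|A|; elim: d A e => // d IHd A e ltd eA.
have [A0|A0] := eqVneq A set0.
  rewrite A0 cards0 /nlmp big_geq //; apply/eqP/cards1P; exists e.
  apply/setP => t; rewrite !inE.
  move: (eA); rewrite A0 => /eqP; rewrite !alpha_eq0 => /eqP->.
  by case: eqP => [->|//]; rewrite eqxx.
case: (treeP e) => [e1|e0 a b e1 _ _ b1 _ eA1 _ er].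
  by rewrite -eA e1 alpha1 eqxx in A0.
have bA : b \in A by rewrite -eA -eA1 setU11.
have cA : #|A| = #|A :\ b|.+1 by rewrite (cardsD1 b A) bA.
have e1A : alpha e1 = A :\ b by rewrite -eA -eA1 setU1K.
rewrite card_treesOf // [X in X * _](_ : _ = #|halves A|); last first.
  by apply: eq_card => y; rewrite inE andbT.
rewrite mulnC (card_alpha_halves A).2 cA /= nlmpS; congr (_ * _).
rewrite -(IHd (A :\ b) e1) //; last by rewrite -ltnS -cA.
rewrite -[RHS](card_imset _ (can_inj (f := pair b) (g := snd) (fun=> erefl))).
apply: eq_card => -[c t]; rewrite !inE /= er; apply/andP/imsetP.
  case=> /andP[cA' tA] /eqP[cb rt]; exists t; last by rewrite cb.
  by rewrite inE /= -cb tA rt eqxx.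
by case=> u; rewrite !inE => /and3P[uA _ /eqP ur] [-> ->];
  rewrite bA uA ur eqxx.
Qed.

Lemma card_lmp_rmp e :
  #|treesOf (alpha e) (pred1 (lmp e)) (pred1 (rmp e))| =
  \prod_(1 <= j < #|alpha e|) j ^ (2 ^ (#|alpha e| - j + 1) - 2).
Proof.
case: (treeP e) => [e1|e0 a b e1 _ a0 b1 eA0 eA1 el er].
  rewrite e1 alpha1 cards0 big_geq //; apply/eqP/cards1P; exists (1%g : tree n).
  apply/setP => t; rewrite !inE -alpha1; case: (eqVneq t 1%g) => [->|t1].
    by rewrite !eqxx.
  by rewrite alpha1 alpha_eq0 (negPf t1).
have A0 : alpha e != set0 by apply/set0Pn; exists a; rewrite -eA0 setU11.
have c0 : #|alpha e| = #|alpha e0|.+1 by rewrite -eA0 cardsU1 a0.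
have c1 : #|alpha e| = #|alpha e1|.+1 by rewrite -eA1 cardsU1 b1.
have c01 : #|alpha e1| = #|alpha e0| by apply: succn_inj; rewrite -c0.
rewrite card_treesOf // c0 -nlmp_sqr -{1}(card_lmp (erefl (alpha e0))) -c01.
rewrite -(card_rmp (erefl (alpha e1))); congr (_ * _).
  rewrite -[RHS](card_imset _ (can_inj (f := pair a) (g := snd) (fun=> erefl))).
  apply: eq_card => -[c t]; rewrite !inE /= el; apply/andP/imsetP.
    case=> /andP[cA' tA] /eqP /rcons_inj[lt ca]; exists t; last by rewrite ca.
    by rewrite inE /= lt eqxx (lmp_alpha lt) eqxx.
  case=> u; rewrite !inE => /and3P[/eqP uA /eqP ul _] [-> ->].
  by rewrite ul uA -eA0 setU1K ?setU11 ?eqxx.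
rewrite -[RHS](card_imset _ (can_inj (f := pair b) (g := snd) (fun=> erefl))).
apply: eq_card => -[c t]; rewrite !inE /= er; apply/andP/imsetP.
  case=> /andP[cA' tA] /eqP[cb rt]; exists t; last by rewrite cb.
  by rewrite inE /= rt eqxx (rmp_alpha rt) eqxx.
case=> u; rewrite !inE => /and3P[/eqP uA _ /eqP ur] [-> ->].
by rewrite ur uA -eA1 setU1K ?setU11 ?eqxx.
Qed.

End CountTrees.

(** * Counting the invariants *)

Lemma card_interval (T : finType) (E Q : {set T}) : E \subset Q ->
  #|[set P : {set T} | (E \subset P) && (P \subset Q)]| = 2 ^ (#|Q| - #|E|).
Proof.
move=> EQ; rewrite -(cardsDS EQ) -card_powerset.
rewrite -(card_in_imset (f := fun P : {set T} => P :|: E)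
  (D := powerset (Q :\: E))).
  apply: eq_card => P; rewrite inE; apply/andP/imsetP => [[EP PQ]|[D]].
    exists (P :\: E); first by rewrite inE setSD.
    by rewrite -{1}(setID P E) (setIidPr EP) setUC.
  rewrite inE => DQ ->; rewrite subsetUr subUset EQ andbT; split=> //.
  by apply: subset_trans DQ (subsetDl _ _).
move=> D D'; rewrite !inE !subsetD => /andP[_ dD] /andP[_ dD'] e.
have rest (X : {set T}) : [disjoint X & E] -> X = (X :|: E) :\: E.
  by move=> dX; rewrite setDUl setDv setU0; apply/esym/setDidPl.
by rewrite (rest _ dD) e -rest.
Qed.

Section CountData.
Variable n : nat.
Implicit Types (t u e : tree n) (A B : {set 'I_n}) (S I : {set tree n}).
Implicit Types (E P Q : {set {set 'I_n}}).

(** A set of trees of S with distinct alphabets filling E is the image of a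
choice function on E. *)
Lemma card_sections S E :
  #|[set I : {set tree n} |
    [&& I \subset S, #|alphas I| == #|I| & alphas I == E]]|
  = \prod_(A in E) #|withAlpha S A|.
Proof.
(* The default value 1 outside E makes a choice function determined by its
   image. *)
pose fam := pfamily (1%g : tree n) E (withAlpha S).
transitivity #|fam|; last by rewrite card_pfamily foldrE big_image.
have famP (f : {ffun {set 'I_n} -> tree n}) : reflect
    ((forall A, A \notin E -> f A = 1%g) /\
     (forall A, A \in E -> f A \in S /\ alpha (f A) = A)) (f \in fam).
  apply: (iffP pfamilyP) => [[/supportP f1 fE]|[f1 fE]]; split=> //.
    by move=> A /fE; rewrite in_withAlpha => /andP[? /eqP].
    by apply/supportP.
  by move=> A /fE[fS fA]; rewrite in_withAlpha fS fA eqxx.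
rewrite -(card_in_imset (f := fun f : {ffun {set 'I_n} -> tree n} => f @: E)
  (D := fam)).
  apply: eq_card => I; rewrite inE; apply/and3P/imsetP.
    case=> /subsetP IS /imset_injP injI /eqP IE.
    exists [ffun A => if A \in E then rep I A else 1%g].
      apply/famP; split=> A AE; rewrite ffunE ?(negPf AE) // AE.
      have /imsetP[t tI ->] : A \in alphas I by rewrite IE.
      by have [rI ra] := repP tI; split; rewrite ?IS.
    apply/setP => t; apply/idP/imsetP => [tI|[A AE ->]]; last first.
      rewrite ffunE AE; have /imsetP[t' tI' ->] : A \in alphas I by rewrite IE.
      by have [] := repP tI'.
    have tE : alpha t \in E by rewrite -IE imset_f.
    exists (alpha t) => //; rewrite ffunE tE.
    by have [rI ra] := repP tI; apply: injI.
  case=> f /famP[f1 fE] ->.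
  have imE : alphas (f @: E) = E.
    rewrite /alphas -imset_comp -[RHS]imset_id; apply: eq_in_imset => A AE.
    by rewrite /= (fE A AE).2.
  split; last by rewrite imE.
    by apply/subsetP => t /imsetP[A AE ->]; case: (fE A AE).
  apply/imset_injP => t u /imsetP[A AE ->] /imsetP[B BE ->].
  by rewrite (fE A AE).2 (fE B BE).2 => ->.
move=> f g /famP[f1 fE] /famP[g1 gE] fg; apply/ffunP => A.
have [AE|AE] := boolP (A \in E); last by rewrite f1 ?g1.
have : f A \in g @: E by rewrite -fg imset_f.
case/imsetP => B BE e; have eB : A = B.
  by rewrite -(proj2 (fE A AE)) -(proj2 (gE B BE)); congr alpha.
by rewrite e eB.
Qed.

Lemma card_withAlpha_m S A : subsemigroup S && replete S -> A \in alphas_m S ->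
  #|withAlpha S A| = \prod_(1 <= j < #|A|) j ^ (2 ^ (#|A| - j + 1) - 2).
Proof.
move=> /rclosedP clS Am; have : A \in alphas S by move: Am;
  rewrite inE => /andP[].
case/imsetP => e eS eA; rewrite {}eA in Am *.
have /(alphas_mP eS)[_ l r] := Am; rewrite -card_lmp_rmp.
apply: eq_card => t; rewrite in_withAlpha !inE;
  apply/andP/and3P => [[tS /eqP te]|[te /eqP lt /eqP rt]].
  by rewrite te eqxx (l _ tS te) (r _ tS te) /= !eqxx.
by split=> //; apply: (rclosed_saturated clS lt rt).
Qed.

Definition admissible_triples :
  {set {set tree n} * {set tree n} * {set {set 'I_n}}} :=
  [set d | admissible d.1.1 d.1.2 d.2].

Lemma card_admissible_triples : #|admissible_triples| =
  \sum_(S : {set tree n} | subsemigroup S && replete S)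
     \sum_(E : {set {set 'I_n}} | E \subset alphas_m S)
       2 ^ (#|alphas S| - #|E|) *
       \prod_(A in E) \prod_(1 <= j < #|A|) j ^ (2 ^ (#|A| - j + 1) - 2).
Proof.
pose ok S I := [&& I \subset S, #|alphas I| == #|I| &
  alphas I \subset alphas_m S].
rewrite -sum1_card.
transitivity (\sum_(S : {set tree n} | subsemigroup S && replete S)
    \sum_(I : {set tree n} | ok S I)
    \sum_(P : {set {set 'I_n}} | (alphas I \subset P) && (P \subset alphas S))
      1).
  rewrite pair_big_dep pair_big_dep /=; apply: eq_bigl => -[[S I] P].
  by rewrite inE /admissible /ok /= !andbA.
apply: eq_bigr => S clS.
rewrite (partition_big (@alphas n) (fun E => E \subset alphas_m S)); last first.
  by move=> I /and3P[].
apply: eq_bigr => E Em.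
have ES : E \subset alphas S.
  by apply: subset_trans Em _; apply/subsetP => A; rewrite inE => /andP[].
transitivity (\sum_(I : {set tree n} | ok S I && (alphas I == E)) 2 ^
  (#|alphas S| - #|E|)).
  apply: eq_bigr => I /andP[_ /eqP ->]; rewrite -(card_interval ES) -sum1_card.
  by apply: eq_bigl => P; rewrite inE.
rewrite sum_nat_const mulnC; congr (_ * _).
transitivity (\prod_(A in E) #|withAlpha S A|).
  rewrite -card_sections; apply: eq_card => I; rewrite inE [LHS]unfold_in /ok.
  by have [->|_] := eqVneq (alphas I) E; rewrite ?andbF // Em !andbT.
by apply: eq_bigr => A AE; apply: card_withAlpha_m => //; apply: (subsetP Em).
Qed.

Definition freeMirig_data (r : freeMirig n) := data (trees (repr r)).

Lemma freeMirig_data_pi (p : freeRig n) :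
  freeMirig_data (\pi_(freeMirig n) p)%qT = data (trees p).
Proof. by apply/same_data_eq/mirigCong_same_data/fm_repr. Qed.

Lemma freeMirig_data_inj : injective freeMirig_data.
Proof.
move=> r r' e; rewrite -[r]reprK -[r']reprK !pi_trees.
exact: value_data e.
Qed.

Lemma freeMirig_data_admissible r : freeMirig_data r \in admissible_triples.
Proof. by rewrite inE; apply: data_admissible. Qed.

Lemma freeMirig_data_surj d : d \in admissible_triples ->
  exists r, freeMirig_data r = d.
Proof.
case: d => -[S I] P; rewrite inE => /admissible_data[s <-].
exists (\pi_(freeMirig n) (seq_mset [seq word t | t <- s] : freeRig n))%qT.
rewrite freeMirig_data_pi; apply/same_data_eq/perm_same_data.
rewrite /trees (perm_trans (perm_map _ (perm_eq_seq_mset _))) //.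
by rewrite mapK //; apply: wordK.
Qed.

End CountData.

From mathcomp Require Import classical_sets cardinality.

Theorem proposition4p30 (n : nat) :
  ([set: freeMirig n] #=
   `I_(\sum_(S : {set tree n} | subsemigroup S && replete S)
        \sum_(E : {set {set 'I_n}} | E \subset alphas_m S)
          2 ^ (#|alphas S| - #|E|) *
          \prod_(A in E) \prod_(1 <= j < #|A|) j ^ (2 ^ (#|A| - j + 1) - 2)))%card.
Proof.
rewrite -card_admissible_triples.
pose V := enum (@admissible_triples n).
pose f (r : freeMirig n) := index (freeMirig_data r) V.
have inV r : freeMirig_data r \in V
  by rewrite mem_enum freeMirig_data_admissible.
have f_inj : injective f.
  move=> r r' e; apply: freeMirig_data_inj.
  rewrite -[RHS](nth_index (freeMirig_data r) (inV r')).
  by rewrite -[LHS](nth_index (freeMirig_data r) (inV r)); congr nth.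
have <- : (f @` [set: freeMirig n] = `I_#|@admissible_triples n|)%classic.
  apply/seteqP; split=> [_ [r _ <-]|k /= kV].
    by rewrite /= cardE index_mem inV.
  have kV' : k < size V by rewrite -cardE.
  (* Only a default value for nth. *)
  pose d := freeMirig_data (0%R : freeMirig n).
  have /freeMirig_data_surj[r er] : nth d V k \in @admissible_triples n.
    by rewrite -mem_enum mem_nth.
  by exists r => //; rewrite /f er index_uniq // enum_uniq.
by rewrite card_eq_sym inj_card_eq // => r r' _ _; apply: f_inj.
Qed.
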